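(* Let $R_u$ be the unipotent radical of $\mathrm{Aut}^0_gA_C$, and let $l$ be the maximum of the dimensions $d(z)$, $z\in W$. Then: a) For all $0\le i\le l$, $L_i=E_0\cdot E_1\cdots E_i$ is a subgroup of $R_u$. b) $L_l=E_0\cdot E_1\cdots E_l$ is isomorphic to $R_u$. c) $L_i$ is a normal subgroup of $R_u$ and $L_i/L_{i-1}$ is an additive group (with $L_{-1}$ trivial).
   Context: $k$ is an algebraically closed field of characteristic $0$. $M$ is a free $\mathbb Z$-module of finite rank, $M^*=\mathrm{Hom}_{\mathbb Z}(M,\mathbb Z)$, $T_M=\mathrm{Spec}\,k[M]$. $X$ is a complete toric variety over $k$ with torus $T_M$, given by a fan $\Delta$ in $M^*\otimes\mathbb Q$. The rays of $\Delta$ are identified with their primitive generators (epimorphisms) $v_i:M\to\mathbb Z$; $\Delta_1=\{v_1,\dots,v_r\}$ is the set of rays and $H_1,\dots,H_r$ are the corresponding $T_M$-invariant irreducible hypersurfaces. $N$ is the Weil divisor class group of $X$, with exact sequence $0\to M\xrightarrow{v}\mathbb Z^r\xrightarrow{\pi}N\to0$, $v(\alpha)=(v_1(\alpha),\dots,v_r(\alpha))$, $\pi(n_1,\dots,n_r)=[\sum n_iH_i]$. $A_C=k[y_1,\dots,y_r]$ is graded by $N$ via $\deg y^n=\pi(n)$. $\mathrm{Aut}_gA_C$ is the affine algebraic group of $N$-graded $k$-algebra automorphisms of $A_C$ and $\mathrm{Aut}_g^0A_C$ its identity component. Roots: $v_i$ also denotes the $i$-th coordinate $\mathbb Z^r\to\mathbb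 Z$. A root associated to $v_i$ is an element $\rho\in\ker\pi=v(M)$ with $v_i(\rho)=-1$ and $v_j(\rho)\ge0$ for all $j\ne i$. A root $\rho$ is semisimple if $-\rho$ is also a root; it is associated to $(v_i,v_j)$ if $\rho$ is associated to $v_i$ and $-\rho$ to $v_j$. Define $v_i\equiv v_j$ if $v_i=v_j$ or there is a semisimple root associated to $(v_i,v_j)$ (an equivalence relation); $W=\Delta_1/\equiv$. Write $v_i<v_j$ if there is a non-semisimple root $\rho$ associated to $v_i$ with $v_j(\rho)>0$; for $F,F'\in W$ write $F<F'$ if $v_i<v_j$ for some $v_i\in F$, $v_j\in F'$. This is a (strict) partial order on $W$. Let $\rho_1,\dots,\rho_m$ be all the non-semisimple roots associated to $v_i$. For $t=(t_1,\dots,t_m)$ let $\tau_t$ be the graded automorphism of $A_C$ with $\tau_t(y^n)=y^n(1+t_1y^{\rho_1}+\dots+t_my^{\rho_m})^{v_i(n)}$, $n\in\mathbb N^r$. $V_i$ is the image of the injective group morphism $\mathbb A^m\to\mathrm{Aut}_gA_C$, $t\mapsto\tau_t$ (an additive group; $V_i$ is trivial if $m=0$). For $F\in W$, $V_F=\prod_{v_i\in F}V_i$, an additive subgroup of $\mathrm{Aut}_gA_C$. For $z\in W$, the dimension $d(z)$ is the maximum $h\geq 0$ such that there is a chain $z_1<\dots<z_h<z$ in $W$ (so minimal elements have dimension $0$). $W_i=\{z\in W: d(z)=i\}$ and $E_i=\prod_{F\in W_i}V_F$, an additive subgroup of $R_u$. An additive group is a group isomorphic to $\mathbb A^s$ with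 addition. *)

(* Defs.v *)
From HB Require Import structures.
From mathcomp Require Import all_boot all_order all_algebra.
From mathcomp Require Import boolp classical_sets cardinality.
From mathcomp Require Import mpoly.

Set Implicit Arguments.
Unset Strict Implicit.
Unset Printing Implicit Defensive.

Import Order.TTheory GRing.Theory Num.Theory.

Local Open Scope classical_set_scope.
Local Open Scope ring_scope.

(** * Fans

    For M free of finite rank, M^* (x) Q = Hom(M, Q); its points are
    represented by functions M -> rat.  Cones contain only additive ones. *)

Definition free_of_finite_rank (M : zmodType) :=
  exists (d : nat) (b : {additive 'rV[int]_d -> M}), bijective b.

Section Fan.
Variable M : zmodType.
Implicit Types (sigma tau : set (M -> rat)) (Delta : set (set (M -> rat))).

Definition cone n (u : 'I_n -> {additive M -> int}) : set (M -> rat) :=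
  [set w | exists2 c : 'I_n -> rat, (forall i, 0 <= c i) &
           forall m, w m = \sum_(i < n) c i * (u i m)%:~R].

Definition rational_cone sigma :=
  exists (n : nat) (u : 'I_n -> {additive M -> int}), sigma = cone u.

Definition strongly_convex sigma :=
  forall w, sigma w -> sigma (fun m => - w m) -> forall m, w m = 0.

Definition face tau sigma :=
  exists m : M, (forall w, sigma w -> 0 <= w m) /\
                tau = [set w | sigma w /\ w m = 0].

Definition is_fan Delta :=
  [/\ finite_set Delta,
      forall sigma, Delta sigma -> rational_cone sigma /\ strongly_convex sigma,
      forall sigma tau, Delta sigma -> face tau sigma -> Delta tau &
      forall sigma tau, Delta sigma -> Delta tau ->
        face (sigma `&` tau) sigma /\ face (sigma `&` tau) tau].

(* The toric variety of a fan is complete iff the fan covers the space. *)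
Definition complete_fan Delta :=
  forall w : {additive M -> rat}, exists2 sigma, Delta sigma & sigma w.

Definition epi (u : {additive M -> int}) := forall z, exists m, u m = z.

(* v lists without repetition the primitive generators of the rays of Delta. *)
Definition rays_of Delta r (v : 'I_r -> {additive M -> int}) :=
  [/\ forall i, epi (v i) /\ Delta (cone (fun _ : 'I_1 => v i)),
      forall i j, v i =1 v j -> i = j &
      forall u : {additive M -> int}, epi u ->
        Delta (cone (fun _ : 'I_1 => u)) -> exists i, v i =1 u].

(* Exactness of 0 -> M -> Z^r -> N -> 0, where the first map is
   alpha |-> (v_1(alpha), ..., v_r(alpha)).  For the rays of a complete fan it
   identifies N with the class group of the toric variety. *)
Definition class_group_sequence r (v : 'I_r -> {additive M -> int})
    (N : zmodType) (pi : {additive 'rV[int]_r -> N}) :=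
  [/\ injective (fun a => \row_i v i a),
      forall n, pi n = 0 <-> exists a, n = \row_i v i a &
      forall x, exists n, pi n = x].

End Fan.

(** * Affine algebraic groups

    An affine algebraic group is a group G together with its algebra reg of
    regular functions G -> k; its subsets carry the restricted functions. *)

Section AlgebraicGroup.
Variables (k : fieldType) (G : groupType) (reg : set (G -> k)).
Implicit Types (g h x y : G) (H K U C D : set G).

Definition zariski_closed C :=
  exists2 S : set (G -> k), S `<=` reg & C = [set g | forall f, S f -> f g = 0].

Definition zariski_connected H :=
  forall C D, zariski_closed C -> zariski_closed D ->
    H `<=` C `|` D -> H `&` C `&` D = set0 -> H `<=` C \/ H `<=` D.

Definition identity_component : set G :=
  [set g | exists H, [/\ zariski_connected H, H 1%g & H g]].

Definition subgroup H :=
  [/\ H 1%g, forall x y, H x -> H y -> H (x * y)%g &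
      forall x, H x -> H x^-1%g].

Definition closed_subgroup H := subgroup H /\ zariski_closed H.

Definition normal_in K H :=
  K `<=` H /\ forall x h, K x -> H h -> K (h * x * h^-1)%g.

(* g acts on regular functions by (g.f)(x) = f(xg), and g is unipotent iff
   g - 1 is locally nilpotent for this action. *)
Definition unipotent g :=
  forall f, reg f -> exists n,
    forall x, iter n (fun (f : G -> k) x => f (x * g)%g - f x) f x = 0.

(* The largest closed connected normal unipotent subgroup of H, as the union of
   all such subgroups. *)
Definition unipotent_radical H : set G :=
  [set g | exists U, [/\ closed_subgroup U, zariski_connected U, normal_in U H,
                         U `<=` unipotent & U g]].

Definition regular_on H (f : G -> k) :=
  exists2 f', reg f' & forall g, H g -> f g = f' g.

Definition alg_isomorphic H K :=
  exists phi psi : G -> G,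
  [/\ (forall g, H g -> K (phi g) /\ psi (phi g) = g),
      (forall g, K g -> H (psi g) /\ phi (psi g) = g),
      (forall g h, H g -> H h -> phi (g * h)%g = (phi g * phi h)%g),
      (forall f, reg f -> regular_on H (fun g => f (phi g))) &
      (forall f, reg f -> regular_on K (fun g => f (psi g)))].

(* L/K is isomorphic to A^s with addition.  phi is the composite of L -> L/K
   with the isomorphism; the regular functions on L/K are the regular functions
   on L which are constant on the cosets of K. *)
Definition additive_quotient (L K : set G) :=
  exists (s : nat) (phi : G -> 'rV[k]_s),
  [/\ (forall g h, L g -> L h -> phi (g * h)%g = phi g + phi h),
      (forall u, exists2 g, L g & phi g = u),
      (forall g, L g -> (phi g = 0 <-> K g)) &
      (forall f : G -> k,
         (regular_on L f /\ (forall g h, L g -> K h -> f (g * h)%g = f g)) <->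
         (exists p : {mpoly k[s]},
            forall g, L g -> f g = p.@[fun j => phi g 0 j]))].

End AlgebraicGroup.

Definition setmulg (G : groupType) (A B : set G) : set G :=
  [set g | exists x y, [/\ A x, B y & g = (x * y)%g]].

(* The ordered product A_1 A_2 ... A_n of a list of subsets of G. *)
Definition setprodg (G : groupType) (s : seq (set G)) : set G :=
  foldr (@setmulg G) [set 1%g] s.

(** * Graded automorphisms of the Cox ring *)

Section GradedAutomorphisms.
Variables (k : fieldType) (r : nat) (N : zmodType).
Variable pi : {additive 'rV[int]_r -> N}.

Definition homogeneous (w : N) (p : {mpoly k[r]}) :=
  forall n, n \in msupp p -> pi (\row_i (n i)%:Z) = w.

Record gaut := GAut {
  gaut_fun :> {mpoly k[r]} -> {mpoly k[r]};
  gaut_inv : {mpoly k[r]} -> {mpoly k[r]};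
  gaut_linear : linear gaut_fun;
  gaut_monoid : monoid_morphism gaut_fun;
  gautK : cancel gaut_fun gaut_inv;
  gautVK : cancel gaut_inv gaut_fun;
  gaut_homogeneous : forall w p, homogeneous w (gaut_fun p) <-> homogeneous w p
}.

HB.instance Definition _ (g : gaut) :=
  GRing.isLinear.Build k {mpoly k[r]} {mpoly k[r]} _ g (gaut_linear g).
HB.instance Definition _ (g : gaut) :=
  GRing.isMonoidMorphism.Build {mpoly k[r]} {mpoly k[r]} g (gaut_monoid g).

Lemma gautP (g h : gaut) : gaut_fun g =1 gaut_fun h -> g = h.
Proof.
case: g h => [f f' l m fK fVK ho] [f2 f2' l2 m2 fK2 fVK2 ho2] /= /funext E.
subst f2.
have E' : f' = f2' by apply/funext => p; rewrite -[in LHS](fVK2 p) fK.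
subst f2'; rewrite (Prop_irrelevance l2 l) (Prop_irrelevance m2 m).
by rewrite (Prop_irrelevance fK2 fK) (Prop_irrelevance fVK2 fVK)
           (Prop_irrelevance ho2 ho).
Qed.

Lemma gaut1_monoid : monoid_morphism (@id {mpoly k[r]}).
Proof. by split. Qed.

Definition gaut1 : gaut :=
  @GAut id id (fun _ _ _ => erefl) gaut1_monoid (fun _ => erefl)
    (fun _ => erefl) (fun _ _ => iff_refl _).

Section GroupLaw.
Variables g h : gaut.

Lemma gautM_linear : linear (g \o h).
Proof. by move=> a p q /=; rewrite !linearP. Qed.

Lemma gautM_monoid : monoid_morphism (g \o h).
Proof. by split=> [|p q] /=; rewrite ?rmorph1 ?rmorphM. Qed.

Lemma gautM_homogeneous w p : homogeneous w ((g \o h) p) <-> homogeneous w p.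
Proof. by rewrite /= !gaut_homogeneous. Qed.

Definition gautM : gaut :=
  GAut gautM_linear gautM_monoid (can_comp (@gautK g) (@gautK h))
    (can_comp (@gautVK h) (@gautVK g)) gautM_homogeneous.

Lemma gautV_linear : linear (gaut_inv g).
Proof.
by move=> a p q; apply: (can_inj (@gautK g)); rewrite linearP /= !gautVK.
Qed.

Lemma gautV_monoid : monoid_morphism (gaut_inv g).
Proof.
split=> [|p q]; apply: (can_inj (@gautK g)); first by rewrite gautVK rmorph1.
by rewrite rmorphM /= !gautVK.
Qed.

Lemma gautV_homogeneous w p : homogeneous w (gaut_inv g p) <-> homogeneous w p.
Proof. by rewrite -(gaut_homogeneous g) gautVK. Qed.

Definition gautV : gaut :=
  GAut gautV_linear gautV_monoid (@gautVK g) (@gautK g) gautV_homogeneous.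

End GroupLaw.

HB.instance Definition _ := gen_eqMixin gaut.
HB.instance Definition _ := gen_choiceMixin gaut.

Lemma gautMA : associative gautM. Proof. by move=> f g h; apply: gautP. Qed.
Lemma gaut1M : left_id gaut1 gautM. Proof. by move=> g; apply: gautP. Qed.
Lemma gautM1 : right_id gaut1 gautM. Proof. by move=> g; apply: gautP. Qed.
Lemma gautMV : left_inverse gaut1 gautV gautM.
Proof. by move=> g; apply: gautP => p; exact: (@gautK g p). Qed.
Lemma gautVM : right_inverse gaut1 gautV gautM.
Proof. by move=> g; apply: gautP => p; exact: (@gautVK g p). Qed.

HB.instance Definition _ :=
  isGroup.Build gaut gautMA gaut1M gautM1 gautMV gautVM.

(* Aut_g is a closed subgroup of GL of the (finite dimensional, for a complete
   fan) sum of the graded pieces containing the variables.  Its coordinate ring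
   is generated by the matrix entries of g and of g^-1, which are polynomials in
   the coefficients of the images of the variables. *)
Inductive gaut_regular : (gaut -> k) -> Prop :=
| GRconst c : gaut_regular (fun _ => c)
| GRcoef i n : gaut_regular (fun g => (g 'X_i)@_n)
| GRcoefV i n : gaut_regular (fun g => ((g^-1)%g 'X_i)@_n)
| GRadd f1 f2 : gaut_regular f1 -> gaut_regular f2 ->
    gaut_regular (fun g => f1 g + f2 g)
| GRmul f1 f2 : gaut_regular f1 -> gaut_regular f2 ->
    gaut_regular (fun g => f1 g * f2 g).

End GradedAutomorphisms.

(** * Roots

    Rays are represented by their indices in 'I_r. *)

Section Roots.
Variables (r : nat) (N : zmodType) (pi : {additive 'rV[int]_r -> N}).
Implicit Types (i j : 'I_r) (rho : 'rV[int]_r) (F : {set 'I_r}).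

Definition root_at i rho :=
  [/\ pi rho = 0, rho 0 i = -1 & forall j, j != i -> 0 <= rho 0 j].

Definition is_root rho := exists i, root_at i rho.

Definition semisimple rho := is_root rho /\ is_root (- rho).

Definition nonsemisimple_at i rho := root_at i rho /\ ~ semisimple rho.

Definition ray_equiv i j :=
  i = j \/ exists rho, root_at i rho /\ root_at j (- rho).

Definition ray_lt i j :=
  exists rho, nonsemisimple_at i rho /\ 0 < rho 0 j.

Definition ray_classes : {set {set 'I_r}} :=
  equivalence_partition (fun i j => `[< ray_equiv i j >]) [set: 'I_r]%SET.

Definition class_lt : rel {set 'I_r} :=
  fun F F' => [exists i in F, exists j in F', `[< ray_lt i j >]].

(* z_1 < ... < z_h < z *)
Definition chain_below (z : {set 'I_r}) (c : seq {set 'I_r}) :=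
  all (mem ray_classes) c && sorted class_lt (rcons c z).

(* As < is a strict order, chains have at most #|ray_classes| elements. *)
Definition class_dim (z : {set 'I_r}) : nat :=
  \max_(h < #|ray_classes|.+1
        | [exists c : h.-tuple {set 'I_r}, chain_below z c]) h.

Definition max_dim : nat := \max_(z in ray_classes) class_dim z.

Variable k : fieldType.
Local Notation A := {mpoly k[r]}.
Local Notation Aut := (gaut k pi).

Definition laurent_monomial rho : {fraction A} :=
  \prod_(j < r) (FracField.tofrac ('X_j : A)) ^ (rho 0 j).

(* sigma (y^n) = y^n (1 + \sum_(rho in s) t_rho y^rho)^(v_i(n)) *)
Definition root_automorphism i (s : seq 'rV[int]_r) (t : 'rV[int]_r -> k)
    (sigma : Aut) :=
  forall n : 'X_{1..r},
    FracField.tofrac (sigma 'X_[n]) =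
    FracField.tofrac ('X_[n] : A) *
      (1 + \sum_(rho <- s) FracField.tofrac ((t rho)%:MP : A) * laurent_monomial rho)
        ^+ n i.

Definition V_ray i : set Aut :=
  [set sigma | exists (s : seq 'rV[int]_r) (t : 'rV[int]_r -> k),
     [/\ uniq s, forall rho, rho \in s <-> nonsemisimple_at i rho &
         root_automorphism i s t sigma]].

Definition V_class F : set Aut := setprodg [seq V_ray i | i <- enum F].

Definition E_dim (d : nat) : set Aut :=
  setprodg [seq V_class F | F <- enum ray_classes & class_dim F == d].

(* E_0 E_1 ... E_(n-1), so that L_i = E_prod i.+1 and L_(-1) = E_prod 0 = 1. *)
Definition E_prod (n : nat) : set Aut := setprodg [seq E_dim d | d <- iota 0 n].

End Roots.

Arguments gaut_regular {k r N} pi _.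
Arguments E_prod {r N} pi k n.

(* Main.v *)
(** Completeness of the fan yields a relation [sum c_i v_i = 0] with all
    [c_i > 0], hence a positive grading of the Cox ring which is coarser than the
    grading by [N].  The degree of [y_i] is therefore spanned by the variables
    [y_j], [v_j] equivalent to [v_i], and by nonlinear monomials [y_i y^rho],
    [rho] a non-semisimple root at [v_i], and those only involve variables
    [y_j] with [v_i < v_j].

    The linear parts of the images of the variables form a representation of
    [Aut_g].  Its kernel is triangular, hence connected (it is covered by lines)
    and unipotent; and an element of a normal unipotent subgroup has trivial
    linear part, by a trace argument with transvections.  So the kernel is the
    unipotent radical.  In it, [L_i] is the subgroup fixing all [y_j] with
    [d(v_j) > i], and [E_0 ... E_i] is the corresponding triangular
    factorization. *)
From HB Require Import structures.
Require Import Defs.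
From mathcomp Require Import all_boot all_order all_algebra.
From mathcomp Require Import boolp classical_sets functions cardinality.
From mathcomp Require Import mpoly.
From mathcomp Require Import ring.

Set Implicit Arguments.
Unset Strict Implicit.
Unset Printing Implicit Defensive.

Import Order.TTheory GRing.Theory Num.Theory.

Local Open Scope classical_set_scope.
Local Open Scope ring_scope.

(** * Cones and rays *)

(** The cones of a fan are given by arbitrary generators, so completeness becomes a relation among
    the rays only after each cone is shown to be generated by its edges.

    The weights c_i serve three purposes. Images of variables have no constant term, so linear parts
    compose; monomials of the degree of a variable have bounded total degree; and v_i < v_j forces
    c_j < c_i, so < has no cycles and chains are bounded.

    The radical is a union over all closed connected normal unipotent subgroups, so its maximality
    is a claim about single elements of an arbitrary such subgroup. Normality can be tested only
    against elements known to lie in the identity component. The transvections y_i -> y_i + y_j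
    between variables of equal degree lie there, being on lines through 1, and they suffice to kill
    every off-diagonal linear coefficient. *)

Section Cones.
Variable M : zmodType.

Lemma additive_int_mulrz (u : {additive M -> int}) x z : u (x *~ z) = u x * z.
Proof. by rewrite raddfMz -mulrzr intz. Qed.

(** Gordan's alternative over the integers, by eliminating one functional at a time. The subgroup
    [K] is there for the induction, which passes to the kernel of [a j] in [K]. *)
Lemma gordan (I : eqType) (a : I -> {additive M -> int}) (s : seq I)
    (K : set M) :
  uniq s -> K 0 -> (forall x y, K x -> K y -> K (x - y)) ->
  (exists2 x, K x & forall i, i \in s -> 0 < a i x) \/
  (exists c : I -> int, [/\ forall i, 0 <= c i, exists2 i, i \in s & 0 < c i &
     forall x, K x -> \sum_(i <- s) c i * a i x = 0]).
Proof.
elim: s K => [|j s IH] K /=; first by move=> _ K0 _; left; exists 0.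
case/andP=> js us K0 KB.
have sj i : i \in s -> (i == j) = false.
  by move=> si; apply: contraNF js => /eqP <-.
have KN x : K x -> K (- x) by move=> Kx; rewrite -sub0r; apply: KB.
have KD x y : K x -> K y -> K (x + y).
  by move=> Kx Ky; rewrite -[y]opprK; apply/KB/KN.
have KZ x z : K x -> K (x *~ z).
  move=> Kx; suff Kn n : K (x *+ n) by case: z => n; rewrite ?NegzE ?mulrNz;
    [exact: Kn | apply/KN/Kn].
  by elim: n => [|n Kn]; rewrite ?mulr0n // mulrS; apply: KD.
have [[x' Kx' x'_gt0]|[c [c_ge0 [i0 i0s ci0] cK]]] := IH K us K0 KB; last first.
  right; exists (fun i => if i == j then 0 else c i); split.
  - by move=> i; case: ifP.
  - exists i0; first by rewrite inE i0s orbT.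
    by rewrite sj.
  move=> x Kx; rewrite big_cons eqxx mul0r add0r -[RHS](cK x Kx).
  by apply: eq_big_seq => i si; rewrite sj.
have [aj0|/existsNP[y0 /not_implyP[Ky0 ajy0]]] := pselect (forall x, K x -> a j x = 0).
  right; exists (fun i => (i == j)%:R); split; first by move=> i; case: eqP.
    by exists j; rewrite ?mem_head // eqxx.
  move=> x Kx; rewrite big_cons eqxx mul1r aj0 // add0r big_seq big1 // => i si.
  by rewrite sj // mul0r.
have [y Ky ajy] : exists2 y, K y & 0 < a j y.
  have [y0_gt|y0_le] := ltP 0 (a j y0); first by exists y0.
  exists (- y0); first exact: KN.
  by rewrite raddfN oppr_gt0 lt_neqAle y0_le andbT; apply/eqP.
pose K' := [set x | K x /\ a j x = 0].
have K'0 : K' 0 by split; rewrite ?raddf0.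
have K'B u w : K' u -> K' w -> K' (u - w).
  by move=> [Ku au] [Kw aw]; split; [exact: KB | rewrite raddfB au aw subr0].
have [[x [Kx ajx] x_gt0]|[c [c_ge0 [i0 i0s ci0] cK]]] := IH K' us K'0 K'B.
  (* [a j] vanishes at [x] and is positive at [y]; the multiple of [x] must outweigh the values of
     the other functionals at [y]. *)
  left; pose n := 1 + \sum_(i <- s) `|a i y|.
  have n_ge i : i \in s -> `|a i y| < n.
    move=> si; rewrite /n ltr_pwDl // (perm_big _ (perm_to_rem si)) big_cons /=.
    by rewrite lerDl sumr_ge0.
  exists (x *~ n + y); first by apply: KD Ky; apply: KZ.
  move=> i; rewrite inE raddfD additive_int_mulrz; case/predU1P=> [->|si].
    by rewrite ajx mul0r add0r.
  have n_gt0 : 0 < n by rewrite (le_lt_trans _ (n_ge i si)).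
  have : - a i y < n by rewrite (le_lt_trans _ (n_ge i si)) // -normrN ler_norm.
  rewrite -subr_gt0 opprK => /lt_le_trans; apply.
  by rewrite lerD2r ler_peMl ?(ltW n_gt0) // -gtz0_ge1 x_gt0.
(* [F] vanishes on the kernel of [a j] in [K], hence is proportional to [a j] on [K]. If [F y] is
   positive, then [a j] is positive at [x'], where all the others are; if not, the proportionality
   is itself a nonnegative relation. *)
pose F x := \sum_(i <- s) c i * a i x.
have FE x : K x -> a j y * F x = a j x * F y.
  move=> Kx; apply/eqP; rewrite -subr_eq0; apply/eqP.
  have : K' (x *~ a j y - y *~ a j x).
    split; first by apply: KB; apply: KZ.
    by rewrite raddfB !additive_int_mulrz mulrC subrr.
  move/cK => <-; rewrite !mulr_sumr -sumrB; apply: eq_bigr => i _.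
  rewrite raddfB !additive_int_mulrz; ring.
have [Fy_gt0|Fy_le0] := ltP 0 (F y).
  left; exists x' => // i; rewrite inE => /predU1P[->|]; last exact: x'_gt0.
  have Fx'_gt0 : 0 < F x'.
    rewrite /F (perm_big _ (perm_to_rem i0s)) big_cons /= ltr_pwDl //.
      by rewrite mulr_gt0 ?x'_gt0.
    rewrite big_seq sumr_ge0 // => l /mem_rem sl.
    by rewrite mulr_ge0 // ltW // x'_gt0.
  by rewrite -(pmulr_lgt0 _ Fy_gt0) -FE // mulr_gt0.
right; exists (fun i => if i == j then - F y else a j y * c i); split.
- move=> i; case: eqP => _; first by rewrite oppr_ge0.
  by rewrite mulr_ge0 // ltW.
- exists i0; first by rewrite inE i0s orbT.
  by rewrite sj // mulr_gt0.
move=> x Kx; rewrite big_cons eqxx.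
rewrite (_ : \sum_(i <- s) _ = a j y * F x); first by rewrite FE //; ring.
rewrite mulr_sumr; apply: eq_big_seq => i si.
by rewrite sj // mulrA.
Qed.

(** The image of [u] is a nonzero subgroup of the integers, generated by its least positive element
    [g]. *)
Lemma primitive_multiple (u : {additive M -> int}) :
  (exists m, u m != 0) ->
  exists (u' : {additive M -> int}) (g : nat),
    [/\ (0 < g)%N, epi u' & forall m, u m = g%:Z * u' m].
Proof.
case=> m1 um1; pose P n := `[< (0 < n)%N /\ exists m, u m = n%:Z >].
have exP : exists n, P n.
  exists `|u m1|%N; apply/asboolP; split; first by rewrite absz_gt0.
  have [um1_ge|um1_lt] := leP 0 (u m1).
    by exists m1; rewrite -[LHS]gez0_abs.
  by exists (- m1); rewrite raddfN -[LHS]gez0_abs ?abszN // oppr_ge0 ltW.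
case: (ex_minnP exP) => g /asboolP[g_gt0 [m0 um0]] g_min.
have dvd_g m : (g %| u m)%Z.
  rewrite /dvdz -[_ \in _]/(_ %| _)%N.
  have g_neq0 : g%:Z != 0 by rewrite eqz_nat -lt0n.
  have uE : u (m - m0 *~ (u m %/ g)%Z) = (u m %% g)%Z.
    by rewrite raddfB additive_int_mulrz um0 mulrC [X in X - _](divz_eq _ g) addrC addKr.
  apply/dvdz_mod0P; apply/eqP; apply: contraT => mod_neq0.
  have mod_ge0 := modz_ge0 (u m) g_neq0.
  have := g_min `|(u m %% g)%Z|%N; rewrite leqNgt -ltz_nat gez0_abs //.
  rewrite ltz_pmod ?ltz_nat // => absurd; suff: false by []; apply: absurd.
  apply/asboolP; rewrite absz_gt0; split => //; exists (m - m0 *~ (u m %/ g)%Z).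
  by rewrite uE gez0_abs.
pose f m := (u m %/ g)%Z.
have fE m : u m = g%:Z * f m by rewrite mulrC divzK.
have g_neq0 : g%:Z != 0 by rewrite eqz_nat -lt0n.
have fB : zmod_morphism f.
  by move=> x y; apply: (mulfI g_neq0); rewrite mulrBr -!fE raddfB.
pose u' : {additive M -> int} := HB.pack f (GRing.isZmodMorphism.Build M int f fB).
exists u', g; split => // z; exists (m0 *~ z); apply: (mulfI g_neq0).
by rewrite -[u' _]/(f _) -fE additive_int_mulrz um0.
Qed.

(** In a minimal generating set [S] of sigma every generator spans an edge. An edge is a face, so it
    belongs to the fan and is the ray of some [v l]. *)
Lemma cone_of_rays (Delta : set (set (M -> rat))) r
    (v : 'I_r -> {additive M -> int}) sigma :
  is_fan Delta -> rays_of Delta v -> Delta sigma -> sigma `<=` cone v.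
Proof.
case=> _ rat_convex face_closed _ [_ _ all_rays] Dsigma.
have [[n [u sigmaE]] convex] := rat_convex _ Dsigma.
pose gen (S : {set 'I_n}) := forall w, sigma w ->
  exists c : 'I_n -> rat, [/\ forall i, 0 <= c i, forall i, i \notin S -> c i = 0 &
    forall m, w m = \sum_(i < n) c i * (u i m)%:~R].
have genT : gen [set: 'I_n]%SET.
  by move=> w; rewrite sigmaE => -[c c_ge0 wE]; exists c; split=> // i; rewrite inE.
have [S /minsetP[/asboolP genS minS] _] :=
  @minset_exists _ (fun S => `[< gen S >]) _ (introT (asboolP _) genT).
have in_sigma (c : 'I_n -> rat) w : (forall i, 0 <= c i) ->
    (forall m, w m = \sum_(i < n) c i * (u i m)%:~R) -> sigma w.
  by rewrite sigmaE => ? ?; exists c.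
have sigma_u i : sigma (fun m => (u i m)%:~R).
  apply: (in_sigma (fun j => (j == i)%:R)) => [j|m]; first by case: eqP.
  by rewrite (bigD1 i) //= eqxx mul1r big1 ?addr0 // => j /negbTE->; rewrite mul0r.
have irredundant i (e : 'I_n -> rat) : i \in S -> (forall j, 0 <= e j) ->
    (forall j, j \notin S :\ i -> e j = 0) ->
    (forall m, (u i m)%:~R = \sum_(j < n) e j * (u j m)%:~R) -> False.
  move=> Si e_ge0 e0 uiE.
  suff genSi : gen (S :\ i).
    by have := minS _ (introT (asboolP _) genSi) (subD1set _ _) => /setP/(_ i);
      rewrite !inE eqxx Si.
  move=> w /genS[c [c_ge0 c0 wE]].
  exists (fun j => (if j == i then 0 else c j) + c i * e j); split.
  - by move=> j; rewrite addr_ge0 ?mulr_ge0 //; case: ifP.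
  - move=> j Sj; rewrite e0 // mulr0 addr0; case: eqP => // /eqP ji.
    by rewrite c0 //; apply: contra Sj => Sj; rewrite !inE ji.
  move=> m; rewrite wE (bigD1 i) //= uiE.
  under [in RHS]eq_bigr do rewrite mulrDl -mulrA.
  rewrite big_split /= -mulr_sumr addrC; congr (_ + _).
  rewrite [RHS](bigD1 i) //= eqxx mul0r add0r.
  by apply: eq_bigr => j /negbTE->.
have u_neq0 i : i \in S -> exists m, u i m != 0.
  move=> Si; apply: contrapT => /forallNP ui0.
  apply: (irredundant i (fun=> 0)) => // m; rewrite big1 => [|j _]; last by rewrite mul0r.
  by apply/eqP; rewrite intr_eq0; apply/negPn/negP.
(* Gordan's alternative on the kernel of [u i] yields either the supporting functional of the edge,
   or a combination of the other generators that is a multiple of [u i]. A positive multiple makes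
   [u i] redundant. Otherwise the negative of [u i0] lies in sigma, so [u i0] vanishes by strong
   convexity and is redundant. *)
have edge i : i \in S -> exists m, u i m = 0 /\ forall j, j \in S :\ i -> 0 < u j m.
  move=> Si.
  have KB x y : u i x = 0 -> u i y = 0 -> u i (x - y) = 0.
    by rewrite raddfB => -> ->; rewrite subr0.
  case: (@gordan _ u (enum (S :\ i)) [set x | u i x = 0] (enum_uniq _) (raddf0 _) KB).
    by case=> m um um_gt0; exists m; split=> // j Sj; apply: um_gt0; rewrite mem_enum.
  case=> c0 [c0_ge0 [i0 i0S ci0] c0K].
  have {i0S} i0S : i0 \in S :\ i by rewrite -mem_enum.
  pose c j := if j \in S :\ i then c0 j else 0.
  have c_ge0 j : 0 <= c j by rewrite /c; case: ifP.
  pose F m := \sum_(j < n) c j * u j m.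
  have FK x : u i x = 0 -> F x = 0.
    move=> /c0K; rewrite big_enum big_mkcond /= => Fx; rewrite -[RHS]Fx; apply: eq_bigr => j _.
    by rewrite /c; case: ifP; rewrite ?mul0r.
  have F_add x y : F (x - y) = F x - F y.
    by rewrite /F -sumrB; apply: eq_bigr => j _; rewrite raddfB mulrBr.
  have F_mul x z : F (x *~ z) = F x * z.
    by rewrite /F mulr_suml; apply: eq_bigr => j _; rewrite additive_int_mulrz mulrA.
  have [y uy] : exists y, 0 < u i y.
    have [y uy] := u_neq0 i Si; have [|uy_le] := ltP 0 (u i y); first by exists y.
    by exists (- y); rewrite raddfN oppr_gt0 lt_neqAle uy.
  have FE m : F m * u i y = F y * u i m.
    apply/eqP; rewrite -subr_eq0 -!F_mul -F_add FK //.
    by rewrite raddfB !additive_int_mulrz mulrC subrr.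
  have uiy_neq0 : (u i y)%:~R != 0 :> rat by rewrite intr_eq0 gt_eqF.
  have FEQ m : \sum_(j < n) (c j)%:~R * (u j m)%:~R =
       (F y)%:~R * (u i m)%:~R / (u i y)%:~R :> rat.
    apply: (mulIf uiy_neq0); rewrite divfK // -intrM -FE intrM; congr (_ * _).
    by rewrite /F raddf_sum /=; apply: eq_bigr => j _; rewrite intrM.
  have [Fy_gt0|Fy_le0] := ltP 0 (F y).
    have Fy_neq0 : (F y)%:~R != 0 :> rat by rewrite intr_eq0 gt_eqF.
    case: (irredundant i (fun j => (u i y)%:~R / (F y)%:~R * (c j)%:~R)) => //.
    - by move=> j; rewrite mulr_ge0 ?ler0z // divr_ge0 // ler0z ltW.
    - by move=> j; rewrite /c => /negbTE->; rewrite mulr0.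
    move=> m; rewrite (eq_bigr (fun j => (u i y)%:~R / (F y)%:~R *
      ((c j)%:~R * (u j m)%:~R))) => [|j _]; last by rewrite mulrA.
    by rewrite -mulr_sumr FEQ; field; apply/andP.
  have ui0_0 : forall m, (u i0 m)%:~R = 0 :> rat.
    apply: (convex _ (sigma_u i0)).
    have ci0_gt0 : (0 < c i0) by rewrite /c i0S.
    have ci0_neq0 : (c i0)%:~R != 0 :> rat by rewrite intr_eq0 gt_eqF.
    apply: (in_sigma (fun j => (if j == i0 then 0 else (c j)%:~R / (c i0)%:~R) +
       (j == i)%:R * (- (F y)%:~R / ((c i0)%:~R * (u i y)%:~R)))).
      move=> j; rewrite addr_ge0 //; first by case: ifP => // _; rewrite divr_ge0 // ler0z.
      by rewrite mulr_ge0 // divr_ge0 ?mulr_ge0 ?ler0z ?(ltW uy) // oppr_ge0 lerz0.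
    move=> m; under eq_bigr do rewrite mulrDl.
    rewrite big_split /= [X in _ + X](bigD1 i) //= [X in _ + (_ + X)]big1; last first.
      by move=> j /negbTE->; rewrite !mul0r.
    rewrite eqxx (bigD1 i0) //= eqxx mul0r add0r.
    have := FEQ m; rewrite (bigD1 i0) //= => /(canRL (addKr _)) E.
    rewrite (eq_bigr (fun j => (c i0)%:~R^-1 * ((c j)%:~R * (u j m)%:~R))); last first.
      by move=> j /negbTE->; rewrite mulrA [_^-1 * _]mulrC.
    by rewrite -mulr_sumr E; field; apply/andP.
  case: (irredundant i0 (fun=> 0)) => //; first by move: i0S; rewrite !inE => /andP[].
  by move=> m; rewrite ui0_0 big1 // => j _; rewrite mul0r.
have edge_ray i : i \in S -> exists (l : 'I_r) (g : nat), forall m, u i m = g%:Z * v l m.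
  move=> Si; have [u' [g [g_gt0 epi_u' uE]]] := primitive_multiple (u_neq0 i Si).
  suff /(all_rays u' epi_u')[l vl] : Delta (cone (fun _ : 'I_1 => u')).
    by exists l, g => m; rewrite vl.
  have [m [uim um]] := edge i Si.
  apply: (face_closed sigma) => //; exists m.
  have um_ge0 j : j \in S -> 0 <= u j m.
    move=> Sj; have [->|ji] := eqVneq j i; first by rewrite uim.
    by rewrite ltW // um // !inE ji.
  split=> [w /genS[c [c_ge0 c0 wE]]|].
    rewrite wE sumr_ge0 // => j _; have [Sj|/c0->] := boolP (j \in S); last by rewrite mul0r.
    by rewrite mulr_ge0 // ler0z um_ge0.
  have g_gt0' : 0 < g%:R :> rat by rewrite ltr0n.
  apply/seteqP; split=> w /=.
    move=> [c c_ge0 wE]; split; last first.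
      move: uim; rewrite uE wE big_ord1 => /eqP; rewrite mulf_eq0 eqz_nat.
      by rewrite gtn_eqF //= => /eqP->; rewrite mulr0.
    apply: (in_sigma (fun j => if j == i then c 0 / g%:R else 0)) => [j|x].
      by case: ifP => // _; rewrite divr_ge0.
    rewrite wE big_ord1 (bigD1 i) //= eqxx big1 ?addr0; last first.
      by move=> j /negbTE->; rewrite mul0r.
    by rewrite uE intrM /=; field; rewrite gt_eqF.
  case=> /genS[c [c_ge0 c0 wE]] wm0.
  have cj0 j : j != i -> c j = 0.
    move=> ji; have [Sj|/c0//] := boolP (j \in S).
    have /psumr_eq0P/(_ j isT) : \sum_(j < n) c j * (u j m)%:~R = 0 by rewrite -wE.
    have ge0 l : true -> 0 <= c l * (u l m)%:~R.
      have [Sl|/c0->] := boolP (l \in S); last by rewrite mul0r.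
      by rewrite mulr_ge0 // ler0z um_ge0.
    move=> /(_ ge0)/eqP; rewrite mulf_eq0 intr_eq0 => /orP[/eqP//|].
    by rewrite gt_eqF // um // !inE ji.
  exists (fun=> c i * g%:R) => [_|x]; first by rewrite mulr_ge0 // ltW.
  rewrite wE big_ord1 (bigD1 i) //= big1 ?addr0 => [|j /cj0->]; last by rewrite mul0r.
  by rewrite uE intrM /=; ring.
move=> w /genS[c [c_ge0 c0 wE]].
have /choice[e eE] : forall i, exists e : 'I_r -> rat, (forall l, 0 <= e l) /\
    (i \in S -> forall m, (u i m)%:~R = \sum_(l < r) e l * (v l m)%:~R).
  move=> i; have [/edge_ray[l [g E]]|Si] := boolP (i \in S); last by exists (fun=> 0).
  exists (fun l' => (l' == l)%:R * g%:R); split=> [l'|_ m]; first by rewrite mulr_ge0.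
  rewrite E intrM (bigD1 l) //= eqxx mul1r big1 ?addr0 // => l' /negbTE->.
  by rewrite !mul0r.
exists (fun l => \sum_(i < n) c i * e i l).
  by move=> l; apply: sumr_ge0 => i _; rewrite mulr_ge0 //; case: (eE i).
move=> m; under [RHS]eq_bigr do rewrite mulr_suml.
rewrite exchange_big wE; apply: eq_bigr => i _ /=.
under eq_bigr do rewrite -mulrA.
rewrite -mulr_sumr; have [Si|/c0->] := boolP (i \in S); last by rewrite !mul0r.
by rewrite (eE i).2.
Qed.

(** Some cone contains the negative of the sum of all rays, which is therefore a combination of the
    rays with coefficients [a i] >= 0. Moving it across gives the positive coefficients 1 + [a i],
    and [D] clears their denominators. *)
Lemma positive_relation (Delta : set (set (M -> rat))) r
    (v : 'I_r -> {additive M -> int}) :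
  is_fan Delta -> complete_fan Delta -> rays_of Delta v ->
  exists c : 'I_r -> nat, (forall i, (0 < c i)%N) /\
    forall m, \sum_(i < r) (c i)%:Z * v i m = 0.
Proof.
move=> fanD completeD raysD.
pose f m : rat := - \sum_(i < r) (v i m)%:~R.
have fB : zmod_morphism f.
  move=> x y; rewrite /f -opprD -sumrB; congr (- _); apply: eq_bigr => i _.
  by rewrite raddfB intrB.
pose w : {additive M -> rat} := HB.pack f (GRing.isZmodMorphism.Build M rat f fB).
have [sigma Dsigma sigma_w] := completeD w.
have [a a_ge0 wE] := cone_of_rays fanD raysD Dsigma sigma_w.
have a1_gt0 i : 0 < 1 + a i by rewrite ltr_pwDl.
pose D := \prod_(i < r) denq (1 + a i).
have D_gt0 : 0 < D by apply: prodr_gt0 => i _; exact: denq_gt0.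
have scaled i : exists c : nat, (0 < c)%N /\ c%:R = D%:~R * (1 + a i) :> rat.
  pose z := (\prod_(j < r | j != i) denq (1 + a j)) * numq (1 + a i).
  have zE : z%:~R = D%:~R * (1 + a i).
    rewrite -[X in _ = _ * X]divq_num_den /z /D [in RHS](bigD1 i) //= !intrM.
    by field; rewrite intr_eq0 denq_neq0.
  have z_gt0 : 0 < z by rewrite -(ltr0z rat) zE mulr_gt0 ?ltr0z.
  exists `|z|%N; split; first by rewrite absz_gt0 gt_eqF.
  by rewrite -zE -[in RHS](gtz0_abs z_gt0).
have [c cE] := choice scaled.
exists c; split=> [i|m]; first by case: (cE i).
apply/eqP; rewrite -(intr_eq0 rat) raddf_sum /=; apply/eqP.
rewrite (eq_bigr (fun i => D%:~R * ((v i m)%:~R + a i * (v i m)%:~R))) => [|i _].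
  rewrite -mulr_sumr big_split /= -wE -[w m]/(f m).
  by rewrite /f subrr mulr0.
by rewrite intrM [X in X * _](cE i).2; ring.
Qed.

End Cones.

(** * Automorphisms of the Cox ring *)

Section Polynomials.
Variables (k : fieldType) (r : nat).
Implicit Types (p q : {mpoly k[r]}) (i j l : 'I_r) (m : 'X_{1..r}).

Definition occurs i p := exists2 m, m \in msupp p & (0 < m i)%N.

Lemma mpoly_ring_ind (P : {mpoly k[r]} -> Prop) p :
  (forall a, P a%:MP) -> (forall i, occurs i p -> P 'X_i) ->
  (forall p q, P p -> P q -> P (p + q)) ->
  (forall p q, P p -> P q -> P (p * q)) -> P p.
Proof.
move=> PC PX PD PM; rewrite (mpolyE p) big_seq.
apply: (big_ind P) => [|//|m pm]; first by rewrite -mpolyC0.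
rewrite -mul_mpolyC mpolyXE_id; apply: (PM) => //.
apply: (big_ind P) => [|//|i _]; first by rewrite -mpolyC1.
have PX1 n : (0 < n)%N -> P 'X_i -> P ('X_i ^+ n).
  elim: n => // -[|n] IH _ PXi; first by rewrite expr1.
  by rewrite exprS; apply: (PM) => //; exact: IH.
case: (posnP (m i)) => [->|mi]; first by rewrite expr0 -mpolyC1.
by apply: PX1 => //; apply: PX; exists m.
Qed.

Lemma mcoeffM0 p q : (p * q)@_0%MM = p@_0%MM * q@_0%MM.
Proof. exact: rmorphM. Qed.

Lemma mcoeffM1 p q i :
  (p * q)@_U_(i) = p@_U_(i) * q@_0%MM + p@_0%MM * q@_U_(i).
Proof.
have E (s : {mpoly k[r]}) : s@_U_(i) = s^`M(i)@_0%MM.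
  by rewrite mcoeff_deriv mnm0E mulr1n add0m.
by rewrite !E mderivM mcoeffD !mcoeffM0.
Qed.

End Polynomials.

(** * Ordered products of subsets of a group *)

Section SetProducts.
Variable G : groupType.
Implicit Types (s : seq (set G)).

Lemma setprodg_cat s1 s2 :
  setprodg (s1 ++ s2) = setmulg (setprodg s1) (setprodg s2).
Proof.
elim: s1 => [|B s1 IH] /=; apply/seteqP; split=> g.
- by move=> sg; exists 1%g, g; rewrite mul1g.
- by move=> [x [y [-> sy ->]]]; rewrite mul1g.
- rewrite IH => -[x [_ [Bx [y [z [s1y s2z ->]]] ->]]].
  by exists (x * y)%g, z; rewrite mulgA; split=> //; exists x, y.
move=> [_ [z [[x [y [Bx s1y ->]]] s2z ->]]].
by exists x, (y * z)%g; rewrite mulgA; split=> //; rewrite IH; exists y, z.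
Qed.

Lemma setprodg_flatten T (f : T -> seq (set G)) (xs : seq T) :
  setprodg [seq setprodg (f x) | x <- xs] = setprodg (flatten [seq f x | x <- xs]).
Proof. by elim: xs => //= x xs IH; rewrite setprodg_cat IH. Qed.

End SetProducts.

(** * Local nilpotency of s - 1 for a ring endomorphism s *)

Section LocallyNilpotent.
Variables (B : comPzRingType) (s : B -> B).
Hypothesis sB : zmod_morphism s.
Hypothesis sM : {morph s : x y / x * y}.

(** Used twice: for an automorphism acting on the Cox ring, and for right translation acting on
    functions on the group. *)
Definition locally_nilpotent x := exists n, iter n (fun y => s y - y) x = 0.

Local Notation D := (fun y => s y - y).

Let s0 : s 0 = 0. Proof. by rewrite -[X in s X](subrr 0) sB subrr. Qed.
Let sD x y : s (x + y) = s x + s y.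
Proof. by rewrite -{1}[y]opprK sB -[- y]sub0r sB s0 sub0r opprK. Qed.
Let iter0 n : iter n D 0 = 0.
Proof. by elim: n => //= n ->; rewrite s0 subrr. Qed.
Let iterDD n x y : iter n D (x + y) = iter n D x + iter n D y.
Proof. by elim: n => //= n ->; rewrite sD opprD addrACA. Qed.

Let iter_leq n m x : (n <= m)%N -> iter n D x = 0 -> iter m D x = 0.
Proof. by move=> nm xn; rewrite -(subnK nm) iterD xn iter0. Qed.

Lemma locally_nilpotentD x y :
  locally_nilpotent x -> locally_nilpotent y -> locally_nilpotent (x + y).
Proof.
move=> [n xn] [m ym]; exists (maxn n m); rewrite iterDD.
by rewrite (iter_leq (leq_maxl n m) xn) (iter_leq (leq_maxr n m) ym) addr0.
Qed.

(* s - 1 is a twisted derivation: D (x y) = D x y + x D y + D x D y. *)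
Lemma locally_nilpotentM x y :
  locally_nilpotent x -> locally_nilpotent y -> locally_nilpotent (x * y).
Proof.
move=> [n xn] [m ym]; exists (n + m)%N.
have [h] := ubnP (n + m); elim: h => // h IH in n m x y xn ym *.
rewrite ltnS; case: n xn => [x0 _|n xn]; first by rewrite (x0 : x = 0) mul0r iter0.
case: m ym => [y0 _|m ym]; first by rewrite (y0 : y = 0) mulr0 iter0.
rewrite addSn addnS => nmh; rewrite iterSr.
have -> : D (x * y) = D x * y + x * D y + D x * D y.
  by rewrite sM; ring.
have xn' : iter n D (D x) = 0 by rewrite -iterSr.
have ym' : iter m D (D y) = 0 by rewrite -iterSr.
rewrite !iterDD -[(n + m).+1]addnS IH ?addnS // -addSn IH ?addSn // add0r.
by rewrite (iter_leq (leqnSn _)) ?add0r // IH // ltnW.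
Qed.

End LocallyNilpotent.

(** * Connectedness by polynomial curves *)

Section Curves.
Variables (k : fieldType) (G : groupType) (reg : set (G -> k)).
Hypothesis char0 : [pchar k] =i pred0.

Lemma poly_eq0_char0 (p : {poly k}) : (forall t, p.[t] = 0) -> p = 0.
Proof.
move=> p0; have natI : injective (fun n : nat => n%:R : k).
  have E n m : (n <= m)%N -> n%:R = m%:R :> k -> n = m.
    move=> nm /eqP; rewrite eq_sym -subr_eq0 -natrB // ((pcharf0P k).1 char0) subn_eq0 => mn.
    by apply/eqP; rewrite eqn_leq nm.
  by move=> n m nm; case/orP: (leq_total n m) => /E; [apply | move=> ->].
apply/eqP; apply: contraT => p_neq0.
have := max_poly_roots (rs := [seq n%:R | n <- iota 0 (size p)]) p_neq0.
rewrite size_map size_iota ltnn => -> //; last by rewrite map_inj_uniq ?iota_uniq.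
by apply/allP => t _; rewrite rootE p0.
Qed.

(* On a line joining the base point to g, two closed sets which cover the line
   and miss one of its points each would give two nonzero polynomials with zero
   product. *)
Lemma curve_connected (H : set G) (x : G) : H x ->
  (forall g, H g -> exists curve : k -> G, [/\ curve 0 = x, curve 1 = g,
     forall t, H (curve t) &
     forall f, reg f -> exists p : {poly k}, forall t, f (curve t) = p.[t]]) ->
  zariski_connected reg H.
Proof.
move=> Hx curves.
have half C D : zariski_closed reg C -> zariski_closed reg D ->
    H `<=` C `|` D -> H `&` C `&` D = set0 -> C x -> H `<=` C.
  move=> [SC regC ->] [SD regD ->] HCD CD0 Cx g /curves[curve [c0 c1 Hc reg_c]] f SCf.
  apply: contrapT => fg; have [f' SDf' f'x] : exists2 f', SD f' & f' x <> 0.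
    apply: contrapT => nD; suff : set0 x by [].
    rewrite -CD0; split=> // f' SDf'; apply: contrapT => f'x; apply: nD.
    by exists f'.
  have [p pE] := reg_c f (regC f SCf); have [q qE] := reg_c f' (regD f' SDf').
  have /eqP : p * q = 0.
    apply: poly_eq0_char0 => t; rewrite hornerM -pE -qE.
    by case: (HCD _ (Hc t)) => [/(_ f SCf)->|/(_ f' SDf')->]; rewrite ?mul0r ?mulr0.
  rewrite mulf_eq0 => /orP[] /eqP z0; [apply: fg | apply: f'x].
    by rewrite -c1 pE z0 horner0.
  by rewrite -c0 qE z0 horner0.
move=> C D clC clD HCD CD0; case: (HCD x Hx) => [Cx|Dx]; [left | right].
  exact: half HCD CD0 Cx.
by apply: (half D C) => //; [rewrite setUC | rewrite setIAC].
Qed.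

End Curves.

(** All eigenvalues vanish, so the characteristic polynomial is a power of X. Algebraic closedness
    enters here, to split that polynomial; the study of the radical takes the conclusion as its
    hypothesis [trace0]. *)
Lemma nilpotent_trace (k : closedFieldType) n (B : 'M[k]_n) :
  (forall u : 'rV_n, exists d, iter d (mulmxr B) u = 0) -> \tr B = 0.
Proof.
case: n B => [|n] B nilB; first by rewrite /mxtrace big_ord0.
have [s sE] := closed_field_poly_normal (char_poly B).
have s0 z : z \in s -> z = 0.
  move=> sz; have : root (char_poly B) z.
    by rewrite sE rootZ ?root_prod_XsubC // lead_coef_eq0 monic_neq0 ?char_poly_monic.
  rewrite -eigenvalue_root_char => /eigenvalueP[u uB u_neq0].
  have [d ud] := nilB u; have : z ^+ d *: u = 0.
    rewrite -ud; elim: d {ud} => [|d IH]; first by rewrite scale1r.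
    by rewrite iterS -IH /= -scalemxAl uB scalerA exprSr.
  by move/eqP; rewrite scaler_eq0 (negbTE u_neq0) orbF expf_eq0 => /andP[_ /eqP].
have cB : char_poly B = 'X ^+ n.+1.
  have sX : char_poly B = 'X ^+ size s.
    rewrite sE (monicP (char_poly_monic B)) scale1r big_seq.
    rewrite (eq_bigr (fun=> 'X)) => [|z /s0->]; last by rewrite subr0.
    by rewrite -big_seq big_const_seq count_predT iter_mulr_1.
  by have := size_char_poly B; rewrite sX size_polyXn => -[->].
apply: oppr_inj; rewrite oppr0 -char_poly_trace // cB coefXn /=.
by rewrite ltn_eqF.
Qed.

(** * The Cox ring with a positive weight that factors through its degree *)

Section CoxRing.
Variables (k : fieldType) (r : nat) (N : zmodType).
Variable pi : {additive 'rV[int]_r -> N}.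
Variable c : 'I_r -> nat.
Hypothesis c_gt0 : forall i, (0 < c i)%N.
Hypothesis c_pi : forall n, pi n = 0 -> \sum_(i < r) (c i)%:Z * n 0 i = 0.

Local Notation A := {mpoly k[r]}.
Local Notation G := (gaut k pi).
Local Notation reg := (gaut_regular pi : set (G -> k)).
Implicit Types (p q : A) (i j l : 'I_r) (m : 'X_{1..r}) (g h : G).

Definition mdegN m : N := pi (\row_i (m i)%:Z).

Definition weight m := (\sum_(i < r) c i * m i)%N.

Lemma mdegND m1 m2 : mdegN (m1 + m2)%MM = mdegN m1 + mdegN m2.
Proof.
by rewrite /mdegN -raddfD; congr (pi _); apply/rowP => i; rewrite !mxE mnmDE.
Qed.

Lemma mdegN0 : mdegN 0%MM = 0.
Proof.
by rewrite /mdegN (_ : \row__ _ = 0) ?raddf0 //; apply/rowP => i; rewrite !mxE mnm0E.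
Qed.

(** The difference of the two exponents lies in the kernel of [pi], on which the weights vanish. *)
Lemma mdegN_weight m1 m2 : mdegN m1 = mdegN m2 -> weight m1 = weight m2.
Proof.
move=> E; apply/eqP; rewrite -eqz_nat -subr_eq0 /weight.
have /c_pi : pi (\row_i (m1 i)%:Z - \row_i (m2 i)%:Z) = 0.
  by rewrite raddfB -![pi _]/(mdegN _) E subrr.
under eq_bigr do rewrite !mxE mulrBr -!PoszM.
by rewrite sumrB -!raddf_sum /= => ->.
Qed.

Lemma weightU i : weight U_(i)%MM = c i.
Proof.
rewrite /weight (bigD1 i) //= mnm1E eqxx muln1 big1 ?addn0 // => j ji.
by rewrite mnm1E eq_sym (negbTE ji) muln0.
Qed.

Lemma weightD m1 m2 : weight (m1 + m2)%MM = (weight m1 + weight m2)%N.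
Proof. by rewrite /weight -big_split; apply: eq_bigr => i _; rewrite mnmDE mulnDr. Qed.

Lemma weight_eq0 m : (weight m == 0%N) = (m == 0%MM).
Proof.
rewrite /weight sum_nat_eq0; apply/forallP/eqP => [m0|-> i].
  by apply/mnmP => i; have := m0 i; rewrite muln_eq0 gtn_eqF //= mnm0E => /eqP.
by rewrite mnm0E muln0.
Qed.

Lemma mdeg_weight m : (mdeg m <= weight m)%N.
Proof. by rewrite mdegE leq_sum // => i _; rewrite leq_pmull. Qed.

Lemma mnm_split m i : (0 < m i)%N -> exists m', m = (U_(i) + m')%MM.
Proof.
by move=> mi; exists (m - U_(i))%MM; rewrite addmC submK // lep1mP -lt0n.
Qed.

Lemma homogeneousX m : homogeneous pi (mdegN m) ('X_[m] : A).
Proof. by move=> n; rewrite msuppX inE => /eqP->. Qed.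

Lemma homogeneousC (a : k) : homogeneous pi 0 (a%:MP : A).
Proof. by move=> n; rewrite msuppC; case: eqP => // _; rewrite inE => /eqP->;
  exact: mdegN0. Qed.

Lemma homogeneous0 w : homogeneous pi w (0 : A).
Proof. by move=> n; rewrite msupp0. Qed.

Lemma homogeneousD w p q : homogeneous pi w p -> homogeneous pi w q -> homogeneous pi w (p + q).
Proof. by move=> hp hq n /msuppD_le; rewrite mem_cat => /orP[/hp|/hq]. Qed.

Lemma homogeneousN w p : homogeneous pi w p -> homogeneous pi w (- p).
Proof. by move=> hp n; rewrite (perm_mem (msuppN p)) => /hp. Qed.

Lemma homogeneousZ w (a : k) p : homogeneous pi w p -> homogeneous pi w (a *: p).
Proof. by move=> hp n /msuppZ_le /hp. Qed.

Lemma homogeneousM w1 w2 p q :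
  homogeneous pi w1 p -> homogeneous pi w2 q -> homogeneous pi (w1 + w2) (p * q).
Proof.
move=> hp hq n /msuppM_le /allpairsP[[m1 m2] /= [/hp h1 /hq h2 ->]].
by rewrite -h1 -h2 -!/(mdegN _) -mdegND.
Qed.

Lemma gautM_E g h p : (g * h)%g p = g (h p). Proof. by []. Qed.
Lemma gaut1_E p : (1%g : G) p = p. Proof. by []. Qed.
Lemma gautVK_E g p : (g^-1)%g (g p) = p. Proof. exact: gautK. Qed.
Lemma gautKV_E g p : g ((g^-1)%g p) = p. Proof. exact: gautVK. Qed.

Lemma gautC g (a : k) : g a%:MP = a%:MP.
Proof. by rewrite -[a%:MP]mulr1 mul_mpolyC linearZ rmorph1. Qed.

Lemma gaut_fixes g p : (forall i, occurs i p -> g 'X_i = 'X_i) -> g p = p.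
Proof.
move=> gX; apply: (mpoly_ring_ind (P := fun p => g p = p)) => [a|//|q s|q s].
- exact: gautC.
- by rewrite raddfD /= => -> ->.
by rewrite rmorphM /= => -> ->.
Qed.

Lemma gaut_ext g h : (forall i, g 'X_i = h 'X_i) -> g = h.
Proof.
move=> E; apply: gautP => p.
apply: (mpoly_ring_ind (P := fun p => g p = h p)) => [a|i _|q s|q s].
- by rewrite !gautC.
- exact: E.
- by rewrite !raddfD /= => -> ->.
by rewrite !rmorphM /= => -> ->.
Qed.

Lemma gautX_homogeneous g i : homogeneous pi (mdegN U_(i)) (g 'X_i).
Proof. exact/gaut_homogeneous/homogeneousX. Qed.

Lemma homogeneous_coeff0 i p : homogeneous pi (mdegN U_(i)) p -> p@_0%MM = 0.
Proof.
move=> hp; apply/memN_msupp_eq0/negP => /hp; rewrite -/(mdegN _) => /mdegN_weight.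
by move/eqP; rewrite weightU -[_ == c i]eq_sym gtn_eqF // (eqP (_ : weight 0 == 0%N))
  ?weight_eq0.
Qed.

Lemma gaut_coeff0 g p : (g p)@_0%MM = p@_0%MM.
Proof.
apply: (mpoly_ring_ind (P := fun p => (g p)@_0%MM = p@_0%MM)) => [a|i _|q s|q s].
- by rewrite gautC.
- by rewrite !(homogeneous_coeff0 (i := i)) //;
    [exact: homogeneousX | exact: gautX_homogeneous].
- by rewrite raddfD !mcoeffD => -> ->.
by rewrite rmorphM !mcoeffM0 => -> ->.
Qed.

(** An automorphism preserves the ideal of polynomials without constant term, hence acts on the
    quotient by its square. This is that action in the basis of the variables. *)
Lemma gaut_coeff1 g p j :
  (g p)@_U_(j) = \sum_(l < r) p@_U_(l) * (g 'X_l)@_U_(j).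
Proof.
pose P p := (g p)@_U_(j) = \sum_(l < r) p@_U_(l) * (g 'X_l)@_U_(j).
apply: (@mpoly_ring_ind k r P p) => [a|i _|q s|q s]; rewrite /P.
- rewrite gautC mcoeffC mnm1_eq0 mulr0 big1 // => l _.
  by rewrite mcoeffC mnm1_eq0 mulr0 mul0r.
- rewrite (bigD1 i) //= mcoeffXU eqxx mul1r big1 ?addr0 // => l li.
  by rewrite mcoeffXU eq_sym (negbTE li) mul0r.
- rewrite raddfD mcoeffD => -> ->; rewrite -big_split; apply: eq_bigr => l _.
  by rewrite mcoeffD mulrDl.
rewrite rmorphM mcoeffM1 !gaut_coeff0 => -> ->.
rewrite mulr_suml mulr_sumr -big_split; apply: eq_bigr => l _ /=.
by rewrite mcoeffM1; ring.
Qed.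

(* The graded piece containing the variable of index i is the direct sum of the
   span of the variables in the class of i and of the nonlinear polynomials,
   which are spanned by the monomials y_i y^rho, rho a non-semisimple root. *)
Definition nonlinear i p :=
  homogeneous pi (mdegN U_(i)) p /\ forall l, p@_U_(l) = 0.

Lemma nonlinear0 i : nonlinear i 0.
Proof. by split=> [|l]; [exact: homogeneous0 | rewrite mcoeff0]. Qed.

Lemma nonlinearD i p q : nonlinear i p -> nonlinear i q -> nonlinear i (p + q).
Proof.
move=> [hp lp] [hq lq]; split=> [|l]; first exact: homogeneousD.
by rewrite mcoeffD lp lq addr0.
Qed.

Lemma nonlinearN i p : nonlinear i p -> nonlinear i (- p).
Proof.
move=> [hp lp]; split=> [|l]; first exact: homogeneousN.
by rewrite mcoeffN lp oppr0.
Qed.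

Lemma nonlinearZ i (a : k) p : nonlinear i p -> nonlinear i (a *: p).
Proof.
move=> [hp lp]; split=> [|l]; first exact: homogeneousZ.
by rewrite mcoeffZ lp mulr0.
Qed.

Lemma nonlinear_gaut i g p : nonlinear i p -> nonlinear i (g p).
Proof.
move=> [hp lp]; split=> [|l]; first exact/gaut_homogeneous.
by rewrite gaut_coeff1 big1 // => j _; rewrite lp mul0r.
Qed.

Definition nonlinear_mnm i m := (mdegN m == mdegN U_(i)) && (mdeg m != 1%N).

Lemma nonlinearP i p :
  nonlinear i p <-> forall m, m \in msupp p -> nonlinear_mnm i m.
Proof.
split=> [[hp lp] m pm|hp].
  rewrite /nonlinear_mnm /mdegN hp // eqxx /=; apply/negP => /mdeg1P[l /eqP E].
  by move: pm; rewrite mcoeff_msupp E lp eqxx.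
split=> [m /hp/andP[/eqP //]|l]; apply/memN_msupp_eq0/negP => /hp/andP[_].
by rewrite mdeg1.
Qed.

(** Dividing [m] by y_l leaves a monomial other than 1, of positive weight. All triangularity below
    rests on this inequality. *)
Lemma nonlinear_mnm_weight i m l : nonlinear_mnm i m -> (0 < m l)%N -> (c l < c i)%N.
Proof.
move=> /andP[/eqP/mdegN_weight]; rewrite weightU => wm m1 /mnm_split[m' mE].
rewrite -wm mE weightD weightU -[ltnLHS]addn0 ltn_add2l lt0n weight_eq0.
by apply: contra m1 => /eqP m'0; rewrite mE m'0 addm0 mdeg1.
Qed.

Definition root_of_mnm i m : 'rV[int]_r :=
  \row_j (m j)%:Z - \row_j ((U_(i)%MM : 'X_{1..r}) j)%:Z.

(** A root rho at v_i corresponds to the monomial y_i y^rho, of the same degree as y_i. This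
    monomial is a single variable y_j exactly when the negative of rho is a root, at v_j. *)
Lemma nonsemisimple_atP i rho :
  nonsemisimple_at pi i rho <->
  exists2 m, nonlinear_mnm i m & rho = root_of_mnm i m.
Proof.
have rE m j : root_of_mnm i m 0 j = (m j)%:Z - (i == j)%:R.
  by rewrite !mxE mnm1E; case: (i == j).
split=> [[[pi_rho rho_i rho_ge0] nss]|[m mi ->]].
  (* The exponent at [i] is rho_i + 1 = 0. *)
  pose m := [multinom if j == i then 0%N else absz (rho 0%R j) | j < r].
  have mE : rho = root_of_mnm i m.
    apply/rowP => j; rewrite rE mnmE eq_sym; have [->|ji] := eqVneq j i.
      by rewrite rho_i.
    by rewrite subr0 gez0_abs ?rho_ge0.
  exists m => //; apply/andP; split.
    by rewrite -subr_eq0 /mdegN -raddfB -/(root_of_mnm i m) -mE pi_rho.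
  apply/negP => /mdeg1P[j /eqP mj]; apply: nss; split; first by exists i.
  have ji : j != i.
    by apply/eqP => ji; have := mnmE (fun j => if j == i then 0%N else absz (rho 0%R j)) i;
       rewrite -/m mj ji mnm1E !eqxx.
  exists j; split=> [||l lj]; first by rewrite raddfN pi_rho oppr0.
    rewrite mE mxE rE mj mnm1E.
    by rewrite eqxx eq_sym (negbTE ji) subr0.
  rewrite mE mxE rE mj mnm1E.
  by rewrite eq_sym (negbTE lj) sub0r opprK; case: (i == l).
have mii : m i = 0%N.
  by apply/eqP; rewrite -leqn0 leqNgt; apply/negP => /(nonlinear_mnm_weight mi); rewrite ltnn.
split.
  split=> [||j ji]; last by rewrite rE eq_sym (negbTE ji) subr0.
    by rewrite raddfB; have /andP[/eqP E _] := mi; rewrite -!/(mdegN _) E subrr.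
  by rewrite rE mii eqxx.
case=> _ [j [_ rho_j rho_le]].
have ji : j != i.
  by apply/eqP => ji; move: rho_j; rewrite mxE rE ji mii eqxx.
have mj : m j = 1%N.
  move: rho_j; rewrite mxE rE eq_sym (negbTE ji) subr0 => /eqP; rewrite eqr_opp eqz_nat.
  by move/eqP.
have ml l : l != j -> m l = 0%N.
  move=> lj; have [->//|li] := eqVneq l i.
  have := rho_le l lj; rewrite mxE rE eq_sym (negbTE li) subr0 oppr_ge0.
  by rewrite lez_nat leqn0 => /eqP.
have mE : m = U_(j)%MM.
  apply/mnmP => l; rewrite mnm1E; have [<-//|jl] := eqVneq j l.
  by apply: ml; rewrite eq_sym.
by have /andP[_] := mi; rewrite mE mdeg1.
Qed.

Lemma nonlinear_mnm_ray_lt i m l : nonlinear_mnm i m -> (0 < m l)%N -> ray_lt pi i l.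
Proof.
move=> mi ml; exists (root_of_mnm i m); split; first by apply/nonsemisimple_atP; exists m.
have: l != i by apply: contraTneq (nonlinear_mnm_weight mi ml) => ->; rewrite ltnn.
by rewrite !mxE mnm1E eq_sym => /negbTE->; rewrite subr0 ltz_nat.
Qed.

Lemma nonlinear_ray_lt i p l : nonlinear i p -> occurs l p -> ray_lt pi i l.
Proof. by move=> /nonlinearP hp [m /hp]; apply: nonlinear_mnm_ray_lt. Qed.

Lemma ray_lt_weight i j : ray_lt pi i j -> (c j < c i)%N.
Proof.
case=> rho [/nonsemisimple_atP[m mi ->]]; rewrite !mxE => rho_j.
by apply: (nonlinear_mnm_weight mi); rewrite -ltz_nat (lt_le_trans rho_j) // lerBlDr lerDl.
Qed.

(** A semisimple root associated to (v_i, v_j) has all its other coordinates both >= 0 and <= 0, so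
    it is e_j - e_i; it lies in the kernel of [pi] exactly when y_i and y_j have equal degrees. *)
Lemma ray_equivP i j : ray_equiv pi i j <-> mdegN U_(i) = mdegN U_(j).
Proof.
split=> [[->//|[rho [[pi_rho rho_i rho_ge0] [_ rho_j rho_le0]]]]|E].
  apply/eqP; rewrite -subr_eq0 -raddfB -[X in X == _]opprK -raddfN opprB.
  rewrite (_ : _ - _ = rho) ?pi_rho ?oppr0 //; apply/rowP => l; rewrite !mxE !mnm1E.
  move: rho_j; rewrite mxE => /eqP; rewrite eqr_opp => /eqP rho_j.
  have [<-|jl] := eqVneq j l.
    by case: eqP => [ij|_]; rewrite ?subr0 ?rho_j // -ij rho_i in rho_j.
  have [<-|il] := eqVneq i l; first by rewrite sub0r rho_i.
  rewrite subr0; apply/eqP; rewrite eq_le rho_ge0 1?eq_sym //=.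
  by have := rho_le0 l; rewrite mxE oppr_ge0 eq_sym => ->.
have [->|ij] := eqVneq i j; [by left | right].
exists (root_of_mnm i U_(j)%MM); split; split;
  rewrite ?raddfN ?raddfB -?/(mdegN _) ?E ?subrr ?oppr0 //.
- by rewrite !mxE !mnm1E eqxx eq_sym (negbTE ij).
- by move=> l li; rewrite !mxE !mnm1E [i == l]eq_sym (negbTE li) subr0.
- by rewrite !mxE !mnm1E eqxx (negbTE ij).
by move=> l lj; rewrite !mxE !mnm1E [j == l]eq_sym (negbTE lj) sub0r opprK.
Qed.

(** * Classes of rays and their dimension *)

Lemma ray_classes_partition : finset.partition (ray_classes pi) [set: 'I_r]%SET.
Proof.
apply: equivalence_partitionP => i j l _ _ _ /=.
split=> [|/asboolP/ray_equivP E]; first by apply/asboolP; left.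
by apply/idP/idP => /asboolP/ray_equivP E'; apply/asboolP/ray_equivP; rewrite -E' E.
Qed.

Definition ray_class i := finset.pblock (ray_classes pi) i.

Lemma mem_ray_class i : i \in ray_class i.
Proof. by rewrite finset.mem_pblock (finset.cover_partition ray_classes_partition) inE. Qed.

Lemma ray_class_in i : ray_class i \in ray_classes pi.
Proof. by rewrite finset.pblock_mem // (finset.cover_partition ray_classes_partition) inE. Qed.

Lemma ray_classE i (F : {set 'I_r}) : F \in ray_classes pi -> i \in F -> ray_class i = F.
Proof. by apply: finset.def_pblock; have /and3P[] := ray_classes_partition. Qed.

Lemma ray_class_mdegN i j : ray_class i = ray_class j -> mdegN U_(i) = mdegN U_(j).
Proof.
move=> E; apply/ray_equivP/asboolP; have := mem_ray_class j; rewrite -E.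
rewrite /ray_class pblock_equivalence_partition ?inE // => i' j' l' _ _ _ /=.
split=> [|/asboolP/ray_equivP E1]; first by apply/asboolP; left.
by apply/idP/idP => /asboolP/ray_equivP E'; apply/asboolP/ray_equivP; rewrite -E' E1.
Qed.

(* Any function on W taking the value c_i on the class of v_i would do. *)
Definition class_weight (F : {set 'I_r}) := (\max_(i in F) c i)%N.

Lemma class_weightE i : class_weight (ray_class i) = c i.
Proof.
apply/eqP; rewrite eqn_leq; apply/andP; split.
  apply/bigmax_leqP => j /(ray_classE (ray_class_in i)) /ray_class_mdegN/mdegN_weight.
  by rewrite !weightU => ->.
exact/leq_bigmax_cond/mem_ray_class.
Qed.

Lemma class_lt_weight : {in ray_classes pi &, forall F F',
  class_lt pi F F' -> (class_weight F' < class_weight F)%N}.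
Proof.
move=> F F' WF WF' /existsP[i /andP[Fi /existsP[j /andP[Fj /asboolP ij]]]].
by rewrite -(ray_classE WF Fi) -(ray_classE WF' Fj) !class_weightE; apply: ray_lt_weight.
Qed.

Definition ray_dim i := class_dim pi (ray_class i).

(** A longest chain below the class of [i], extended by that class, is a chain below the class of
    [j]. *)
Lemma ray_lt_dim i j : ray_lt pi i j -> (ray_dim i < ray_dim j)%N.
Proof.
move=> ij; have lt_ij : class_lt pi (ray_class i) (ray_class j).
  apply/existsP; exists i; rewrite mem_ray_class; apply/existsP; exists j.
  by rewrite mem_ray_class; apply/asboolP.
have [h /existsP[t /andP[tW st]] hE] : {h : 'I_#|ray_classes pi|.+1 |
    [exists t : h.-tuple {set 'I_r}, chain_below pi (ray_class i) t] &
    ray_dim i = h}.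
  rewrite /ray_dim /class_dim; apply: eq_bigmax_cond.
  by apply/card_gt0P; exists ord0; apply/existsP; exists [tuple].
have cW : all (mem (ray_classes pi)) (rcons t (ray_class i)).
  by rewrite all_rcons /= ray_class_in.
(* [class_dim] only admits lengths up to the number of classes. Weights strictly decrease along the
   extended chain, so its members are distinct and its length is still admissible. *)
have h_lt : (h < #|ray_classes pi|)%N.
  have st' : sorted (fun F F' => class_weight F' < class_weight F)%N (rcons t (ray_class i)).
    by apply: sub_in_sorted cW st => F F' WF WF'; apply: class_lt_weight.
  rewrite -(size_tuple t) -(size_rcons t (ray_class i)) [X in (_ <= X)%N]cardE;
    apply: uniq_leq_size.
    apply: sorted_uniq st' => [F F' F'' lt1 lt2|F]; [exact: ltn_trans lt2 lt1 | exact: ltnn].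
  by move=> F /(allP cW); rewrite mem_enum.
pose t' := [tuple of rcons t (ray_class i)].
rewrite hE; apply: (@leq_bigmax_cond _ _ _ (Ordinal (h_lt : (h.+1 < _.+1)%N))).
apply/existsP; exists t'; rewrite /chain_below cW /=.
move: st lt_ij; clear; case: (val t) => [|a s] /=; first by rewrite andbT.
by rewrite !rcons_path !last_rcons => -> ->.
Qed.

Lemma ray_dim_max i : (ray_dim i <= max_dim pi)%N.
Proof. exact: (leq_bigmax_cond (F := class_dim pi) _ (ray_class_in i)). Qed.

(** * Elementary automorphisms and the products of the V_i *)

(** Every [q i] involves only variables that are not moved, so the substitution fixes all [q i] and
    is inverted by changing their signs. Root automorphisms, transvections and the section of a
    layer are all of this form. *)
Lemma elementary_gaut (q : 'I_r -> A) :
  (forall i, homogeneous pi (mdegN U_(i)) (q i)) ->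
  (forall i j, occurs j (q i) -> q j = 0) ->
  exists g : G, (forall i, g 'X_i = 'X_i + q i) /\ (forall i, (g^-1)%g 'X_i = 'X_i - q i).
Proof.
move=> hq oq.
pose subst (s : 'I_r -> A) p := p \mPo [tuple 'X_i + s i | i < r].
have substX s i : subst s 'X_i = 'X_i + s i.
  by rewrite /subst comp_mpolyXU -tnth_nth tnth_mktuple.
have subst_fix s p : (forall i, occurs i p -> s i = 0) -> subst s p = p.
  move=> sp; apply: (@mpoly_ring_ind k r (fun p => subst s p = p)) => [a|i /sp si|x y xE
    yE|x y xE yE].
  - exact: comp_mpolyC.
  - by rewrite substX si addr0.
  - by rewrite /subst raddfD /= -!/(subst s _) xE yE.
  by rewrite /subst rmorphM /= -!/(subst s _) xE yE.
have substK s s' : (forall i, s i = - s' i) -> (forall i j, occurs j (s i) -> s' j = 0) ->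
    cancel (subst s) (subst s').
  move=> ss' os p; apply: (@mpoly_ring_ind k r (fun p => subst s' (subst s p) = p)) =>
    [a|i _|x y xE yE|x y xE yE].
  - by rewrite /subst !comp_mpolyC.
  - rewrite substX /subst raddfD /= -!/(subst _ _) substX [X in _ + X]subst_fix; last exact: os.
    by rewrite ss' addrK.
  - by rewrite /subst !raddfD /= -!/(subst _ _) xE yE.
  by rewrite /subst !rmorphM /= -!/(subst _ _) xE yE.
have subst_homog s : (forall i, homogeneous pi (mdegN U_(i)) (s i)) ->
    forall w p, homogeneous pi w p -> homogeneous pi w (subst s p).
  move=> hs w p hp; rewrite (mpolyE p) /subst raddf_sum /= big_seq.
  apply: (big_ind (homogeneous pi w)) => [|x y|m /hp mw];
    [exact: homogeneous0 | exact: homogeneousD |].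
  rewrite linearZ /=; apply: homogeneousZ; rewrite -mw -/(mdegN m) comp_mpolyX.
  rewrite [in mdegN m](multinomUE_id m).
  apply: (big_ind2 (fun x y => homogeneous pi (mdegN x) y)).
  - by rewrite mdegN0 -mpolyC1; apply: homogeneousC.
  - by move=> x1 x2 y1 y2 h1 h2; rewrite mdegND; apply: homogeneousM.
  move=> i _; rewrite tnth_mktuple; elim: (m i) => [|n IH].
    by rewrite mulm0n expr0 mdegN0 -mpolyC1; apply: homogeneousC.
  rewrite mulmS exprS mdegND; apply: homogeneousM => //.
  by apply: homogeneousD => //; apply: homogeneousX.
have occursN i p : occurs i (- p) -> occurs i p.
  by move=> [m pm mi]; exists m => //; rewrite -(perm_mem (msuppN p)).
have qK : cancel (subst q) (subst (fun i => - q i)).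
  apply: substK => [i|i j /oq ->]; by rewrite ?opprK ?oppr0.
have qVK : cancel (subst (fun i => - q i)) (subst q).
  by apply: substK => // i j /occursN/oq.
have hqN i : homogeneous pi (mdegN U_(i)) (- q i) by apply: homogeneousN.
have subst_hom w p : homogeneous pi w (subst q p) <-> homogeneous pi w p.
  split=> [|hp]; last exact: subst_homog.
  by move=> /(subst_homog _ hqN); rewrite qK.
have lin : linear (subst q) by move=> a x y; rewrite /subst linearP.
have mon : monoid_morphism (subst q).
  by split=> [|x y]; rewrite /subst ?rmorph1 ?rmorphM.
exists (GAut lin mon qK qVK subst_hom); split=> i; [exact: substX | exact: substX].
Qed.

(* The nonlinear monomials of degree deg y_i have weight c_i, hence bounded
   total degree. *)
Definition nonlinear_mnms i : seq 'X_{1..r} :=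
  [seq bmnm b | b <- enum {: 'X_{1..r < (c i).+1}} & nonlinear_mnm i (bmnm b)].

Lemma mem_nonlinear_mnms i m : (m \in nonlinear_mnms i) = nonlinear_mnm i m.
Proof.
apply/mapP/idP => [[b]|mi]; first by rewrite mem_filter => /andP[bi _] ->.
have mb : (mdeg m < (c i).+1)%N.
  by have /andP[/eqP/mdegN_weight wm _] := mi; rewrite ltnS -weightU -wm mdeg_weight.
by exists (BMultinom mb) => //; rewrite mem_filter mem_enum inE andbT.
Qed.

Lemma uniq_nonlinear_mnms i : uniq (nonlinear_mnms i).
Proof.
rewrite map_inj_uniq => [|b b' /eqP]; last by rewrite -bmeqP => /eqP.
exact/filter_uniq/enum_uniq.
Qed.

Lemma nonlinear_expansion i p : nonlinear i p ->
  p = \sum_(m <- nonlinear_mnms i) p@_m *: 'X_[m].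
Proof.
move=> /nonlinearP pi_nl; apply/mpolyP => n; rewrite raddf_sum /=.
have [ni|ni] := boolP (n \in nonlinear_mnms i).
  rewrite (bigD1_seq n) ?uniq_nonlinear_mnms //= mcoeffZ mcoeffX eqxx mulr1.
  by rewrite big1 ?addr0 // => m mn; rewrite mcoeffZ mcoeffX (negbTE mn) mulr0.
rewrite memN_msupp_eq0; last by apply: contra ni => /pi_nl; rewrite mem_nonlinear_mnms.
rewrite big_seq big1 // => m mi; rewrite mcoeffZ mcoeffX; case: eqP => [mn|];
  last by rewrite mulr0.
by rewrite -mn mi in ni.
Qed.

Definition mnm_of_root i (rho : 'rV[int]_r) : 'X_{1..r} :=
  [multinom absz (rho 0%R j + ((U_(i)%MM : 'X_{1..r}) j)%:Z)%R | j < r].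

Lemma root_of_mnmK i : cancel (root_of_mnm i) (mnm_of_root i).
Proof. by move=> m; apply/mnmP => j; rewrite mnmE !mxE subrK. Qed.

Local Notation tofrac := (@FracField.tofrac A).

Lemma laurent_root i m :
  tofrac 'X_i * laurent_monomial k (root_of_mnm i m) = tofrac 'X_[m].
Proof.
have X0 j : tofrac 'X_j != 0.
  rewrite tofrac_eq0; apply/eqP => /mpolyP/(_ U_(j)%MM); rewrite mcoeffX eqxx mcoeff0.
  by apply/eqP; exact: oner_neq0.
rewrite /laurent_monomial [in RHS]mpolyXE_id rmorph_prod /=.
rewrite (bigD1 i) //= [RHS](bigD1 i) //= mulrA; congr (_ * _).
  rewrite !mxE mnm1E eqxx rmorphXn /=.
  by rewrite expfzDr // mulrCA -exprnN -exprnP expr1 mulfV ?mulr1.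
apply: eq_bigr => j ji; rewrite !mxE mnm1E eq_sym (negbTE ji) subr0.
by rewrite rmorphXn.
Qed.

(** The defining formula lives in the fraction field. Multiplied by y_i, each y^rho becomes a
    genuine monomial, so the parameters [t] are the coefficients of an arbitrary nonlinear
    polynomial of the degree of y_i. *)
Lemma V_rayP i g :
  V_ray i g <-> nonlinear i (g 'X_i - 'X_i) /\ (forall j, j != i -> g 'X_j = 'X_j).
Proof.
split=> [[s [t [us sE gE]]]|[nl_i g_fix]].
  have sroot rho : rho \in s -> exists2 m, nonlinear_mnm i m & rho = root_of_mnm i m.
    by move/sE/nonsemisimple_atP.
  split=> [|j ji]; last first.
    apply/eqP; rewrite -tofrac_eq; apply/eqP; rewrite gE mnm1E (negbTE ji) expr0 mulr1 //.
  rewrite (_ : _ - _ = \sum_(rho <- s) t rho *: 'X_[mnm_of_root i rho]).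
    rewrite big_seq; apply: (big_ind (nonlinear i)) => [|x y|rho].
    - exact: nonlinear0.
    - exact: nonlinearD.
    move=> /sroot[m mi ->]; rewrite root_of_mnmK; apply: nonlinearZ; apply/nonlinearP => n.
    by rewrite msuppX inE => /eqP->.
  apply/eqP; rewrite -tofrac_eq; apply/eqP;
    rewrite raddfB /= gE mnm1E eqxx expr1 mulrDr mulr1 addrC addKr.
  rewrite mulr_sumr raddf_sum; apply: eq_big_seq => rho /sroot[m _ ->] /=.
  by rewrite mulrCA laurent_root root_of_mnmK -mul_mpolyC rmorphM.
set p := _ - _ in nl_i.
exists [seq root_of_mnm i m | m <- nonlinear_mnms i], (fun rho => p@_(mnm_of_root i rho)).
split.
- by rewrite map_inj_uniq ?uniq_nonlinear_mnms //; exact: can_inj (@root_of_mnmK i).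
- move=> rho; split=> [/mapP[m]|/nonsemisimple_atP[m mi ->]].
    by rewrite mem_nonlinear_mnms => mi ->; apply/nonsemisimple_atP; exists m.
  by apply: map_f; rewrite mem_nonlinear_mnms.
move=> n; rewrite big_map; set S := 1 + _.
have gXi : tofrac (g 'X_i) = tofrac 'X_i * S.
  rewrite /S mulrDr mulr1 mulr_sumr -[g 'X_i](subrK 'X_i) -/p addrC raddfD /=; congr (_ + _).
  rewrite [in LHS](nonlinear_expansion nl_i) raddf_sum; apply: eq_bigr => m _ /=.
  by rewrite mulrCA laurent_root root_of_mnmK -mul_mpolyC rmorphM.
rewrite mpolyXE_id !rmorph_prod /= (bigD1 i) //= [X in _ = X * _](bigD1 i) //=.
rewrite !rmorphXn /= gXi exprMn -!mulrA; congr (_ * _); rewrite mulrC; congr (_ * _).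
by apply: eq_bigr => j ji; rewrite !rmorphXn /= g_fix.
Qed.

(** [T] marks the variables that may move: all of them for the radical, those of dimension at most i
    for L_i. *)
Definition Uset (T : pred 'I_r) : set G :=
  [set g | forall j, nonlinear j (g 'X_j - 'X_j) /\ (~~ T j -> g 'X_j = 'X_j)].

Lemma V_ray_ex i p : nonlinear i p -> exists g : G,
  [/\ V_ray i g, g 'X_i = 'X_i + p, (g^-1)%g 'X_i = 'X_i - p &
      forall j, j != i -> (g^-1)%g 'X_j = 'X_j].
Proof.
move=> nl_p; pose q j := if j == i then p else 0.
have [|j l|g [gX gVX]] := @elementary_gaut q.
- by move=> j; rewrite /q; case: eqP => [->|_]; [case: nl_p | exact: homogeneous0].
- rewrite /q; case: (j == i); last by case=> m; rewrite msupp0.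
  by move/(nonlinear_ray_lt nl_p)/ray_lt_weight; case: (l =P i) => // ->; rewrite ltnn.
have qi : q i = p by rewrite /q eqxx.
have qj j : j != i -> q j = 0 by rewrite /q => /negbTE->.
exists g; rewrite gX gVX qi; split=> // [|j /qj ji]; last by rewrite gVX ji subr0.
by apply/V_rayP; rewrite gX qi addrC addKr; split=> // j /qj ji; rewrite gX ji addr0.
Qed.

(** The last factor [e] is split off on the right, chosen to agree with [g] on y_i. The difference
    of [g 'X_i] and y_i involves only variables of larger dimension than any ray of the list, so [g]
    fixes it and g e^-1 fixes y_i. This is why the list must be ordered by dimension. *)
Lemma setprodg_V_rays (s : seq 'I_r) :
  pairwise (fun i j => ray_dim i <= ray_dim j)%N s ->
  setprodg [seq V_ray i | i <- s] = Uset (fun j => j \in s).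
Proof.
elim/last_ind: s => [_|s i IH] /=.
  apply/seteqP; split=> g /=; first by move=> -> j; rewrite gaut1_E subrr; split=> //;
    exact: nonlinear0.
  by move=> gU; apply: gaut_ext => j; rewrite (gU j).2.
rewrite pairwise_rcons => /andP[/allP si /IH {}IH].
rewrite -cats1 map_cat setprodg_cat IH /=; apply/seteqP; split=> g /=.
  move=> [x [y [xU [z [_ [/V_rayP[z_nl z_fix] -> ->]]] ->]]] j; rewrite mulg1.
  have [ji|ji] := eqVneq j i; last first.
    rewrite gautM_E z_fix //; split=> [|/= sj]; first by case: (xU j).
    by rewrite (xU j).2 //; apply: contra sj; rewrite mem_cat => ->.
  rewrite ji; split=> [|/=]; last by rewrite mem_cat mem_seq1 eqxx orbT.
  rewrite gautM_E -[z 'X_i](subrK 'X_i) raddfD /= -addrA.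
  by apply: nonlinearD; [exact: nonlinear_gaut | case: (xU i)].
move=> gU; have [e [Ve eX eVX eV_fix]] := V_ray_ex (gU i).1.
exists (g * e^-1)%g, e; rewrite mulgVK; split=> //; last by exists e, 1%g; rewrite mulg1.
move=> j; have [->|ji] := eqVneq j i; last first.
  rewrite gautM_E eV_fix //; split=> [|/= sj]; first by case: (gU j).
  by rewrite (gU j).2 //= mem_cat mem_seq1 negb_or sj.
rewrite gautM_E eVX; suff -> : g ('X_i - (g 'X_i - 'X_i)) = 'X_i.
  by rewrite subrr; split=> //; exact: nonlinear0.
rewrite raddfB /= [X in _ - X](_ : _ = g 'X_i - 'X_i) ?subKr //.
apply: gaut_fixes => l /(nonlinear_ray_lt (gU i).1)/ray_lt_dim lt_il.
rewrite (gU l).2 //; apply/negP; rewrite /= mem_cat mem_seq1 => /orP[/si|/eqP li].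
  by rewrite leqNgt lt_il.
by rewrite li ltnn in lt_il.
Qed.

(** The nested products over dimensions, classes and rays flatten to one product along this list. *)
Definition ray_list n : seq 'I_r :=
  flatten [seq flatten [seq enum F | F : {set 'I_r} <- enum (ray_classes pi) & class_dim
    pi F == d]
          | d <- iota 0 n].

Lemma E_prod_ray_list n : E_prod pi k n = setprodg [seq V_ray i | i <- ray_list n].
Proof.
have E d : E_dim d = setprodg (flatten [seq [seq (V_ray i : set G) | i <- enum F] |
    F : {set 'I_r} <- enum (ray_classes pi) & class_dim pi F == d]).
  by rewrite -setprodg_flatten.
rewrite /E_prod (eq_map E) setprodg_flatten /ray_list map_flatten -map_comp;
  congr (setprodg (flatten _)).
by apply: eq_map => d /=; rewrite map_flatten -map_comp.
Qed.

Lemma mem_ray_block d i :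
  (i \in flatten [seq enum F | F : {set 'I_r} <- enum (ray_classes pi) & class_dim pi F == d]) =
  (ray_dim i == d).
Proof.
apply/flatten_mapP/eqP => [[F]|<-].
  rewrite mem_filter mem_enum => /andP[/eqP <- WF]; rewrite mem_enum => Fi.
  by rewrite /ray_dim (ray_classE WF Fi).
by exists (ray_class i);
  rewrite ?mem_enum ?mem_ray_class // mem_filter mem_enum ray_class_in eqxx.
Qed.

Lemma mem_ray_list n i : (i \in ray_list n) = (ray_dim i < n)%N.
Proof.
apply/flatten_mapP/idP => [[d]|lt_in]; first by rewrite mem_iota mem_ray_block => dn /eqP->.
by exists (ray_dim i); rewrite ?mem_iota // mem_ray_block.
Qed.

Lemma pairwise_ray_list n : pairwise (fun i j => ray_dim i <= ray_dim j)%N (ray_list n).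
Proof.
elim: n => // n IH; rewrite /ray_list -addn1 iotaD map_cat flatten_cat pairwise_cat IH /=.
rewrite cats0 -/(ray_list n); apply/andP; split.
  apply/allrelP => i j; rewrite mem_ray_list mem_ray_block => lt_in /eqP->.
  exact: ltnW.
have: {in flatten [seq enum F | F : {set 'I_r} <- enum (ray_classes pi) & class_dim pi F
  == n], forall i, ray_dim i = n}.
  by move=> i; rewrite mem_ray_block => /eqP.
elim: (flatten _) => //= i s IHs sn; apply/andP; split; last first.
  by apply: IHs => j js; apply: sn; rewrite inE js orbT.
by apply/allP => j js; rewrite !sn ?mem_head // inE js orbT.
Qed.

Lemma E_prodE n : E_prod pi k n = Uset (fun i => ray_dim i < n)%N.
Proof.
rewrite E_prod_ray_list setprodg_V_rays ?pairwise_ray_list //.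
by apply/seteqP; split=> g gU j; have := gU j; rewrite /= mem_ray_list.
Qed.

(** * The unipotent radical *)

Lemma unipotent_coeff1 g i l : Uset predT g -> (g 'X_i)@_U_(l) = (i == l)%:R.
Proof.
move=> gU; rewrite -[g 'X_i](subrK 'X_i) mcoeffD mcoeffXU.
by have [[_ ->] _] := gU i; rewrite add0r.
Qed.

Lemma Uset_predTP g :
  Uset predT g <-> forall i l, (g 'X_i)@_U_(l) = (i == l)%:R.
Proof.
split=> [gU i l|gE j]; first exact: unipotent_coeff1.
split=> //; split=> [|l]; last by rewrite mcoeffB mcoeffXU gE subrr.
apply: homogeneousD; first exact: gautX_homogeneous.
exact/homogeneousN/homogeneousX.
Qed.

Lemma Uset_sub (T T' : pred 'I_r) : (forall i, T i -> T' i) -> Uset T `<=` Uset T'.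
Proof.
move=> TT' g gT j; split=> [|nT']; first by case: (gT j).
by apply: (gT j).2; apply: contra nT'; exact: TT'.
Qed.

Lemma Uset_sub_predT T : Uset T `<=` Uset predT.
Proof. exact: Uset_sub. Qed.

Lemma Uset_subgroup T : subgroup (Uset T).
Proof.
split=> [j|x y xT yT j|x xT j].
- by rewrite gaut1_E subrr; split=> //; exact: nonlinear0.
- rewrite gautM_E; split=> [|nT]; last by rewrite (yT j).2 // (xT j).2.
  rewrite -[y 'X_j](subrK 'X_j) raddfD /= -addrA.
  by apply: nonlinearD; [apply: nonlinear_gaut; case: (yT j) | case: (xT j)].
split=> [|nT]; last by rewrite -[in LHS]((xT j).2 nT) gautVK_E.
rewrite -[X in _ - X](gautVK_E x) -opprB -raddfB.
by apply/nonlinearN/nonlinear_gaut; case: (xT j).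
Qed.

Lemma Uset_closed T : zariski_closed reg (Uset T).
Proof.
exists [set f | exists i m, ~~ (nonlinear_mnm i m && T i) /\
                f = fun g => (g 'X_i)@_m + - ('X_i : A)@_m].
  by move=> _ [i [m [_ ->]]]; apply: GRadd; [exact: GRcoef | exact: GRconst].
apply/seteqP; split=> g /= gT.
  move=> _ [i [m [im ->]]]; rewrite -mcoeffB.
  have [Ti|nTi] := boolP (T i); last by rewrite (gT i).2 // subrr mcoeff0.
  apply/memN_msupp_eq0/negP => pm; move: im; rewrite Ti andbT => /negP; apply.
  by have [/nonlinearP/(_ _ pm)] := gT i.
have g0 i m : ~~ (nonlinear_mnm i m && T i) -> (g 'X_i - 'X_i)@_m = 0.
  by move=> im; rewrite mcoeffB; apply: (gT (fun g => (g 'X_i)@_m + - ('X_i : A)@_m));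
    exists i, m.
move=> j; split=> [|nT].
  apply/nonlinearP => m; rewrite mcoeff_msupp; apply: contraNT => jm.
  by rewrite g0 // negb_and jm.
by apply/eqP; rewrite -subr_eq0; apply/eqP/mpolyP => m; rewrite mcoeff0 g0 // negb_and nT orbT.
Qed.

Lemma Uset_conj T g h : Uset T g -> Uset predT (h * g * h^-1)%g.
Proof.
move=> /Uset_sub_predT gU; apply/Uset_predTP => i l.
rewrite !gautM_E gaut_coeff1 -[RHS](mcoeffXU k) -[in RHS](gautKV_E h 'X_i) [RHS]gaut_coeff1.
apply: eq_bigr => a _; congr (_ * _); rewrite gaut_coeff1 (bigD1 a) //= big1 ?addr0.
  by rewrite unipotent_coeff1 // eqxx mulr1.
by move=> b ba; rewrite unipotent_coeff1 // (negbTE ba) mulr0.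
Qed.

(** If v_j has dimension at least [n], then [(h^-1) 'X_j] involves only y_j and variables of larger
    dimension, all fixed by [x]. *)
Lemma Uset_normal n :
  normal_in (Uset (fun i => ray_dim i < n)%N) (Uset predT).
Proof.
split=> [|x h xn hU]; first exact: Uset_sub_predT.
move=> j; split=> [|]; first by case: (Uset_conj h xn j).
rewrite -leqNgt => nj.
have [_ _ /(_ h hU) hVU] := Uset_subgroup predT.
rewrite !gautM_E [x _]gaut_fixes ?gautKV_E // => l.
have hVj := (hVU j).1; set q := _ - _ in hVj.
have -> : (h^-1)%g 'X_j = q + 'X_j by rewrite subrK.
case=> m /msuppD_le; rewrite mem_cat => /orP[qm ml|]; last first.
  rewrite msuppX inE => /eqP->; rewrite mnm1E; case: eqP => // <- _.
  by apply: (xn j).2; rewrite -leqNgt.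
apply: (xn l).2; rewrite -leqNgt (leq_trans nj) // ltnW //.
by apply/ray_lt_dim/(nonlinear_ray_lt hVj); exists m.
Qed.

Lemma locally_nilpotent_gaut g p :
  Uset predT g -> exists n, iter n (fun q => g q - q) p = 0.
Proof.
move=> gU; pose nil q := locally_nilpotent g q.
have gM : {morph (g : A -> A) : x y / x * y} by move=> x y; rewrite rmorphM.
have gB : zmod_morphism g by move=> x y; rewrite raddfB.
have nilC (a : k) : nil a%:MP by exists 1%N; rewrite /= gautC subrr.
(* Induction on the weight: g - 1 sends y_i to a polynomial in variables of smaller weight. *)
suff nilX n i : (c i < n)%N -> nil 'X_i.
  apply: (@mpoly_ring_ind k r nil p) => // [i _|x y|x y].
  - exact: nilX (ltnSn _).
  - exact: locally_nilpotentD.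
  exact: locally_nilpotentM.
elim: n i => // n IH i; rewrite ltnS => ci.
suff [m mE] : nil (g 'X_i - 'X_i) by exists m.+1; rewrite iterSr.
apply: (@mpoly_ring_ind k r nil _) => // [l /(nonlinear_ray_lt (gU i).1)/ray_lt_weight
  lt_l|x y|x y].
- exact: IH (leq_trans lt_l ci).
- exact: locally_nilpotentD.
exact: locally_nilpotentM.
Qed.

(** A uniform exponent is needed for the coefficient functions of inverses: there g^-1 - 1 acts on
    [(h^-1) 'X_i], which varies with [h] within one graded piece. Finitely many monomials span that
    piece. *)
Lemma nilpotent_on_degree g i : Uset predT g ->
  exists n, forall p, homogeneous pi (mdegN U_(i)) p -> iter n (fun q => g q - q) p = 0.
Proof.
move=> gU; pose D q := g q - q.
have DD n : {morph iter n D : x y / x + y}.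
  elim: n => [//|n IH] x y; rewrite !iterS IH /D; by rewrite raddfD opprD addrACA.
have DZ n (a : k) x : iter n D (a *: x) = a *: iter n D x.
  by elim: n => [//|n IH]; rewrite !iterS IH /D linearZ -scalerBr.
have D0 n : iter n D 0 = 0 by elim: n => [//|n IH]; rewrite iterS IH /D raddf0 subrr.
have /choice[e eE] : forall b : 'X_{1..r < (c i).+1}, exists n, iter n D 'X_[bmnm b] = 0.
  by move=> b; apply: locally_nilpotent_gaut.
exists (\max_(b : 'X_{1..r < (c i).+1}) e b)%N => p hp.
rewrite -/D (mpolyE p) [X in iter _ _ X]big_seq.
apply: (big_ind (fun q => iter _ D q = 0)) => [|x y xE yE|m pm].
- exact: D0.
- by rewrite DD xE yE addr0.
have mi : mdegN m = mdegN U_(i) := hp m pm.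
have mb : (mdeg m < (c i).+1)%N.
  by rewrite ltnS -weightU -(mdegN_weight mi) mdeg_weight.
rewrite DZ -(subnK (leq_bigmax (BMultinom mb))) iterD /=.
by rewrite (eE (BMultinom mb)) D0 scaler0.
Qed.

Lemma Uset_unipotent : Uset predT `<=` unipotent reg.
Proof.
move=> g gU f; pose s (f : G -> k) x := f (x * g)%g.
have DE : (fun (f : G -> k) x => f (x * g)%g - f x) = (fun f => s f - f).
  by apply/funext => f'; apply/funext.
have sB : zmod_morphism s by move=> x y; apply/funext.
have sM : {morph s : x y / x * y} by move=> x y; apply/funext.
suff nil : reg f -> locally_nilpotent s f.
  by move=> /nil[n nE]; exists n => x; rewrite DE nE.
elim=> [a|i m|i m|f1 f2 _ IH1 _ IH2|f1 f2 _ IH1 _ IH2].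
- by exists 1%N; apply/funext => x /=; rewrite -[LHS]/(a - a) subrr.
(* Since (h g) p = h (g p), the difference operator passes inside [h] and becomes g - 1 acting on
   y_i. *)
- have [n nE] := locally_nilpotent_gaut 'X_i gU; exists n; apply/funext => x.
  suff -> : iter n (fun f => s f - f) (fun h : G => (h 'X_i)@_m) =
     (fun h : G => (h (iter n (fun q => g q - q) 'X_i))@_m).
    by rewrite nE raddf0 mcoeff0.
  elim: n {nE} => //= n ->; apply/funext => h.
  by rewrite -[LHS]/((h (g _))@_m - (h _)@_m) raddfB mcoeffB.
- have [_ _ /(_ g gU) gVU] := Uset_subgroup predT.
  have [n nE] := nilpotent_on_degree i gVU; exists n; apply/funext => x.
  suff -> : iter n (fun f => s f - f) (fun h : G => ((h^-1)%g 'X_i)@_m) =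
     (fun h : G => (iter n (fun q => (g^-1)%g q - q) ((h^-1)%g 'X_i))@_m).
    by rewrite nE ?mcoeff0 //; exact: gautX_homogeneous.
  elim: n {nE} => //= n ->; apply/funext => h; pose T q := (g^-1)%g q - q.
  rewrite -[LHS]/((iter n T (((h * g)^-1)%g 'X_i))@_m - (iter n T ((h^-1)%g 'X_i))@_m).
  have TB x' y' : iter n T x' - iter n T y' = iter n T (x' - y').
    elim: n => [//|n IH]; rewrite !iterS -IH.
    by move: (iter n T x') (iter n T y') => u v; rewrite /T [(g^-1)%g (u - v)]raddfB /=; ring.
  by rewrite -mcoeffB invgM gautM_E TB -[iter n T _]/(iter n T (T _)) -iterSr.
- exact: locally_nilpotentD.
exact: locally_nilpotentM.
Qed.

(** * Polynomial curves in the automorphism group *)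

Definition poly_family (P : k -> A) :=
  exists Q : {poly A}, forall t, P t = Q.[t%:MP].

Lemma poly_familyC p : poly_family (fun=> p).
Proof. by exists p%:P => t; rewrite hornerC. Qed.

Lemma poly_familyD P Q : poly_family P -> poly_family Q -> poly_family (fun t => P t + Q t).
Proof. by move=> [p pE] [q qE]; exists (p + q) => t; rewrite hornerD pE qE. Qed.

Lemma poly_familyM P Q : poly_family P -> poly_family Q -> poly_family (fun t => P t * Q t).
Proof. by move=> [p pE] [q qE]; exists (p * q) => t; rewrite hornerM pE qE. Qed.

Lemma poly_family_scale p : poly_family (fun t => t *: p).
Proof.
by exists (p *: 'X) => t; rewrite hornerZ hornerX mulrC mul_mpolyC.
Qed.

Lemma poly_family_apply (curve : k -> G) P :
  (forall i, poly_family (fun t => curve t 'X_i)) -> poly_family P ->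
  poly_family (fun t => curve t (P t)).
Proof.
move=> cX [Q PE].
have cp p : poly_family (fun t => curve t p).
  apply: (@mpoly_ring_ind k r (fun p => poly_family (fun t => curve t p))) => [a|i _|x y
    hx hy|x y hx hy].
  - exists a%:MP%:P => t; by rewrite hornerC gautC.
  - exact: cX.
  - rewrite (_ : (fun _ => _) = (fun t => curve t x + curve t y)); first exact: poly_familyD.
    by apply/funext => t; rewrite raddfD.
  rewrite (_ : (fun _ => _) = (fun t => curve t x * curve t y)); first exact: poly_familyM.
  by apply/funext => t; rewrite rmorphM.
have -> : (fun t => curve t (P t)) =
    (fun t => \sum_(i < size Q) curve t Q`_i * t%:MP ^+ i).
  apply/funext => t; rewrite PE horner_coef raddf_sum; apply: eq_bigr => i _ /=.
  by rewrite rmorphM rmorphXn /= gautC.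
have tX (n : nat) : poly_family (fun t => t%:MP ^+ n).
  by exists ('X ^+ n) => t; rewrite hornerXn.
elim: (size Q) => [|n IH].
  exists 0 => t; by rewrite big_ord0 horner0.
rewrite (_ : (fun _ => _) = (fun t => (\sum_(i < n) curve t Q`_i * t%:MP ^+ i) + curve t
  Q`_n * t%:MP ^+ n)).
  exact: (poly_familyD IH (poly_familyM (cp _) (tX n))).
by apply/funext => t; rewrite big_ord_recr.
Qed.

(** Inverses are included because their coefficients are among the generators of the regular
    functions. *)
Definition poly_curve (curve : k -> G) :=
  (forall i, poly_family (fun t => curve t 'X_i)) /\
  (forall i, poly_family (fun t => (curve t)^-1%g 'X_i)).

Lemma poly_curveM c1 c2 : poly_curve c1 -> poly_curve c2 ->
  poly_curve (fun t => c1 t * c2 t)%g.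
Proof.
move=> [c1X c1VX] [c2X c2VX]; split=> i.
  exact: (poly_family_apply c1X (c2X i)).
rewrite (_ : (fun _ => _) = (fun t => (c2 t)^-1%g ((c1 t)^-1%g 'X_i))).
  exact: (poly_family_apply (curve := fun t => (c2 t)^-1%g) c2VX (c1VX i)).
by apply/funext => t; rewrite invgM.
Qed.

Lemma poly_curve_regular curve f : poly_curve curve -> reg f ->
  exists p : {poly k}, forall t, f (curve t) = p.[t].
Proof.
move=> [cX cVX].
have coef P m : poly_family P -> exists p : {poly k}, forall t, (P t)@_m = p.[t].
  move=> [Q PE]; exists (\poly_(i < size Q) (Q`_i)@_m) => t.
  rewrite PE horner_coef horner_poly raddf_sum /=; apply: eq_bigr => i _.
  by rewrite -rmorphXn /= mulrC mul_mpolyC mcoeffZ mulrC.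
elim=> [a|i m|i m|f1 f2 _ [p pE] _ [q qE]|f1 f2 _ [p pE] _ [q qE]].
- by exists a%:P => t; rewrite hornerC.
- exact: coef (cX i).
- exact: coef (cVX i).
- by exists (p + q) => t; rewrite hornerD pE qE.
by exists (p * q) => t; rewrite hornerM pE qE.
Qed.

Lemma elementary_curve (q : 'I_r -> A) :
  (forall i, homogeneous pi (mdegN U_(i)) (q i)) ->
  (forall i j, occurs j (q i) -> q j = 0) ->
  exists curve : k -> G, [/\ poly_curve curve, forall t i, curve t 'X_i = 'X_i + t *: q i,
    curve 0 = 1%g & forall t i, (curve t)^-1%g 'X_i = 'X_i - t *: q i].
Proof.
move=> hq oq.
have /choice[curve curveE] : forall t, exists g : G,
    (forall i, g 'X_i = 'X_i + t *: q i) /\ (forall i, g^-1%g 'X_i = 'X_i - t *: q i).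
  move=> t; apply: (elementary_gaut (q := fun i => t *: q i)) => [i|i j].
    exact: homogeneousZ.
  by case=> m /msuppZ_le qm mj; rewrite (oq i j) ?scaler0 //; exists m.
exists curve; split.
- split=> i.
    rewrite (_ : (fun _ => _) = (fun t => 'X_i + t *: q i)); last by apply/funext => t;
      rewrite (curveE t).1.
    by apply: poly_familyD; [exact: poly_familyC | exact: poly_family_scale].
  rewrite (_ : (fun _ => _) = (fun t => 'X_i + t *: - q i)).
    by apply: poly_familyD; [exact: poly_familyC | exact: poly_family_scale].
  by apply/funext => t; rewrite (curveE t).2 scalerN.
- by move=> t i; rewrite (curveE t).1.
- by apply: gaut_ext => i; rewrite (curveE 0).1 scale0r addr0.
by move=> t i; rewrite (curveE t).2.
Qed.

(** Each factor moves a single variable; scaling all these displacements by t contracts [g] to 1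
    inside the product. *)
Lemma V_rays_curve (s : seq 'I_r) g : setprodg [seq V_ray i | i <- s] g ->
  exists curve : k -> G, [/\ poly_curve curve, curve 0 = 1%g, curve 1 = g &
    forall t, setprodg [seq V_ray i | i <- s] (curve t)].
Proof.
elim: s g => [|i s IH] g /=.
  move=> ->; exists (fun=> 1%g); split=> //; split=> j; rewrite ?invg1; exact: poly_familyC.
move=> [x [y [/V_rayP[x_nl x_fix] /IH[cy [cy_poly cy0 cy1 cyH]] ->]]].
pose q j := if j == i then x 'X_i - 'X_i else 0.
have qi : q i = x 'X_i - 'X_i by rewrite /q eqxx.
have qj j : j != i -> q j = 0 by rewrite /q => /negbTE->.
have [||cx [cx_poly cxX cx0 _]] := @elementary_curve q.
- by move=> j; rewrite /q; case: eqP => [->|_]; [case: x_nl | exact: homogeneous0].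
- move=> j l; rewrite {1}/q; case: eqP => _; last by case=> m; rewrite msupp0.
  by move/(nonlinear_ray_lt x_nl)/ray_lt_weight => li; apply: qj;
    apply: contraTneq li => ->; rewrite ltnn.
exists (fun t => cx t * cy t)%g; split.
- exact: poly_curveM.
- by rewrite cx0 cy0 mulg1.
- rewrite cy1; congr (_ * _)%g; apply: gaut_ext => j; rewrite cxX scale1r.
  have [->|ji] := eqVneq j i; first by rewrite qi addrC subrK.
  by rewrite qj // addr0 x_fix.
move=> t; exists (cx t), (cy t); split=> //; apply/V_rayP; split=> [|j ji].
  by rewrite cxX addrC addKr qi; apply: nonlinearZ.
by rewrite cxX qj // scaler0 addr0.
Qed.

Lemma Uset_dim_predT : Uset (fun i => ray_dim i < (max_dim pi).+1)%N = Uset predT.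
Proof.
apply/seteqP; split; first exact: Uset_sub_predT.
by apply: Uset_sub => i _; rewrite ltnS ray_dim_max.
Qed.

Section Radical.
Hypothesis char0 : [pchar k] =i pred0.
Hypothesis trace0 : forall B : 'M[k]_r,
  (forall u : 'rV_r, exists d, iter d (mulmxr B) u = 0) -> \tr B = 0.

Local Notation Aut0 := (identity_component reg).

Lemma Uset_connected : zariski_connected reg (Uset predT).
Proof.
rewrite -Uset_dim_predT -E_prodE E_prod_ray_list.
apply: (curve_connected char0 (x := 1%g)).
  rewrite -E_prod_ray_list E_prodE;
    by have [] := Uset_subgroup (fun i => ray_dim i < (max_dim pi).+1)%N.
move=> g /V_rays_curve[curve [c_poly c0 c1 cH]]; exists curve; split=> // f.
exact: poly_curve_regular.
Qed.

Lemma Uset_sub_radical : Uset predT `<=` unipotent_radical reg Aut0.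
Proof.
move=> g gU; exists (Uset predT); split=> //.
- by split; [exact: Uset_subgroup | exact: Uset_closed].
- exact: Uset_connected.
- split=> [x xU|x h xU _]; last exact: Uset_conj xU.
  by exists (Uset predT); split=> //; [exact: Uset_connected | case: (Uset_subgroup predT)].
exact: Uset_unipotent.
Qed.

(** Row i holds the coefficients of the image of y_i, so products are reversed in [linear_partM]. *)
Definition linear_part g : 'M[k]_r := \matrix_(i, l) (g 'X_i)@_U_(l).

Lemma linear_partM g h : linear_part (g * h)%g = linear_part h *m linear_part g.
Proof.
apply/matrixP => i l; rewrite !mxE gautM_E gaut_coeff1.
by apply: eq_bigr => a _; rewrite !mxE.
Qed.

Lemma linear_part1 : linear_part 1%g = 1%:M.
Proof. by apply/matrixP => i l; rewrite !mxE gaut1_E mcoeffXU. Qed.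

Lemma regular_sum (I : Type) (s : seq I) (F : I -> G -> k) :
  (forall x, reg (F x)) -> reg (fun g => \sum_(x <- s) F x g).
Proof.
move=> regF; elim: s => [|x s IH].
  rewrite (_ : (fun _ => _) = (fun=> 0)); first exact: GRconst.
  by apply/funext => g; rewrite big_nil.
rewrite (_ : (fun _ => _) = (fun g => F x g + \sum_(y <- s) F y g)); first exact: GRadd.
by apply/funext => g; rewrite big_cons.
Qed.

(* g acts on the linear coordinate functions of h through h -> h g, i.e. by
   left multiplication of the linear part of h by that of g. *)
Lemma unipotent_linear_part g (u : 'rV[k]_r) : unipotent reg g ->
  exists d, iter d (mulmxr (linear_part g - 1%:M)) u = 0.
Proof.
move=> g_unip; pose B := linear_part g - 1%:M.
pose D (f : G -> k) x := f (x * g)%g - f x.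
pose F (w : 'rV[k]_r) j x := (w *m linear_part x) 0 j.
have regF w j : reg (F w j).
  rewrite (_ : F w j = (fun x => \sum_(i < r) w 0 i * (x 'X_i)@_U_(j))).
    by apply: regular_sum => i; apply: GRmul; [exact: GRconst | exact: GRcoef].
  by apply/funext => x; rewrite /F mxE; apply: eq_bigr => i _; rewrite mxE.
have DF n w j : iter n D (F w j) = F (iter n (mulmxr B) w) j.
  elim: n => //= n ->; apply/funext => x; rewrite /D /F linear_partM.
  by rewrite /= [_ *m B]mulmxBr mulmx1 mulmxBl mulmxA [RHS]mxE [X in _ = _ + X]mxE.
have D0 n : iter n D (fun=> 0) = (fun=> 0).
  by elim: n => //= n ->; apply/funext => x; rewrite /D subrr.
have /choice[e eE] : forall j, exists n, iter n D (F u j) = (fun=> 0).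
  move=> j; have [n nE] := g_unip _ (regF u j).
  by exists n; apply/funext => x; apply: nE.
exists (\max_j e j)%N; apply/rowP => j; rewrite [RHS]mxE.
have : iter (\max_j e j)%N D (F u j) 1%g = 0.
  by rewrite -(subnK (leq_bigmax j)) iterD eE D0.
by rewrite DF /F linear_part1 mulmx1.
Qed.

Lemma unipotent_trace g : unipotent reg g -> \tr (linear_part g) = r%:R.
Proof.
move=> g_unip; apply/eqP; rewrite -mxtrace1 -subr_eq0 -raddfB; apply/eqP/trace0 => u.
exact: unipotent_linear_part.
Qed.

(* y_i -> y_i + y_j lies on the line y_i -> y_i + t y_j, for i, j in the same class. *)
Lemma transvection_Aut0 i j : i != j -> mdegN U_(i) = mdegN U_(j) ->
  exists e : G, [/\ Aut0 e, linear_part e = 1%:M + delta_mx i j &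
                    linear_part e^-1%g = 1%:M - delta_mx i j].
Proof.
move=> ij dij; pose q l : A := if l == i then 'X_j else 0.
have [||curve [c_poly cX c0 cVX]] := @elementary_curve q.
- move=> l; rewrite /q; case: eqP => [->|_]; last exact: homogeneous0.
  by rewrite dij; apply: homogeneousX.
- move=> a b; rewrite {1}/q; case: eqP => _; last by case=> m; rewrite msupp0.
  case=> m; rewrite msuppX inE => /eqP->; rewrite mnm1E /q.
  by case: (j =P b) => // <- _; rewrite eq_sym (negbTE ij).
have qE a b : (q a)@_U_(b) = (delta_mx i j : 'M[k]_r) a b.
  rewrite /q mxE; case: eqP => _ /=; last by rewrite mcoeff0.
  by rewrite mcoeffXU eq_sym.
exists (curve 1); split.
- exists (range curve); split; last by exists 1.
    apply: (curve_connected char0 (x := 1%g)); first by exists 0.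
    (* The rescaled line a -> [curve (a * t)] joins 1 to [curve t]. *)
    move=> _ [t _ <-]; have [||cv [cv_poly cvX cv0 _]] := @elementary_curve (fun l => t *: q l).
    + move=> l; apply: homogeneousZ; rewrite /q; case: eqP => [->|_]; last exact: homogeneous0.
      by rewrite dij; apply: homogeneousX.
    + move=> a b [m /msuppZ_le]; rewrite {1}/q; case: eqP => _; last by rewrite msupp0.
      rewrite msuppX inE => /eqP->; rewrite mnm1E /q.
      by case: (j =P b) => // <- _; rewrite eq_sym (negbTE ij) scaler0.
    have cvE a : cv a = curve (a * t).
      by apply: gaut_ext => l; rewrite cvX cX scalerA.
    exists cv; split=> // [|a|f]; first by rewrite cvE mul1r.
      by exists (a * t).
    exact: poly_curve_regular.
  by exists 0.
- by apply/matrixP => a b; rewrite !mxE cX scale1r mcoeffD mcoeffXU qE mxE.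
by apply/matrixP => a b; rewrite !mxE cVX scale1r mcoeffB mcoeffXU qE mxE.
Qed.

(* If A is the linear part of an element of a normal unipotent subgroup and
   E = E_ij, then A^2 and (1 - E) A (1 + E) A are unipotent, and comparing their
   traces gives A_ji ^ 2 = tr (E A E A) = 0. *)
Lemma radical_sub_Uset : unipotent_radical reg Aut0 `<=` Uset predT.
Proof.
move=> g [V [[[V1 VM _] _] _ [_ Vnormal] Vunip Vg]].
pose B := linear_part g.
have offdiag i j : i != j -> B j i = 0.
  move=> ij; have [dij|dij] := eqVneq (mdegN U_(i)) (mdegN U_(j)); last first.
    rewrite mxE; apply/memN_msupp_eq0; apply/negP => gji.
    by move/eqP: dij; apply; have := gautX_homogeneous gji.
  have [e [Ae eE eVE]] := transvection_Aut0 ij dij.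
  have := unipotent_trace (Vunip _ (VM _ _ Vg (Vnormal _ _ Vg Ae))).
  rewrite -(unipotent_trace (Vunip _ (VM _ _ Vg Vg))) !linear_partM -/B eE eVE.
  set E := delta_mx i j.
  rewrite !mulmxA !mulmxBl !mulmxDr !mulmxDl !mulmx1 !mul1mx !raddfB !raddfD /=.
  have -> : \tr (B *m E *m B) = \tr (E *m B *m B).
    by rewrite -mulmxA mxtrace_mulC.
  move/eqP; rewrite -subr_eq0 => /eqP E0; apply/eqP.
  have : \tr (E *m B *m E *m B) = 0.
    by rewrite -[LHS]opprK -oppr0; congr (- _); rewrite -[RHS]E0; ring.
  have -> : \tr (E *m B *m E *m B) = B j i * B j i.
    have EB a b : (E *m B) a b = (a == i)%:R * B j b.
      rewrite mxE (bigD1 j) //= big1 ?addr0 => [|l lj]; rewrite mxE ?eqxx ?andbT //.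
      by rewrite (negbTE lj) andbF mul0r.
    rewrite -mulmxA /mxtrace (bigD1 i) //= big1 ?addr0 => [|a ai]; last first.
      by rewrite mxE big1 // => l _; rewrite EB (negbTE ai) !mul0r.
    rewrite mxE (bigD1 i) //= big1 ?addr0 => [|l li];
      last by rewrite [X in _ * X]EB (negbTE li) mul0r mulr0.
    by rewrite !EB eqxx !mul1r.
  by move/eqP; rewrite mulf_eq0 orbb.
(* As B is now diagonal, the i-th basis vector is an eigenvector of the nilpotent B - 1, with
   eigenvalue B_ii - 1. *)
have diag i : B i i = 1.
  have [d dE] := unipotent_linear_part (delta_mx 0 i) (Vunip _ Vg).
  have dB : (delta_mx 0 i : 'rV_r) *m (B - 1%:M) = (B i i - 1) *: delta_mx 0 i.
    apply/rowP => l; rewrite -rowE.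
    have -> : row i (B - 1%:M) 0 l = B i l - (i == l)%:R by rewrite !mxE.
    have -> : ((B i i - 1) *: (delta_mx 0 i : 'rV_r)) 0 l = (B i i - 1) * (l == i)%:R by
      rewrite !mxE.
    have [->|li] := eqVneq l i; first by rewrite mulr1.
    by rewrite offdiag // subr0 mulr0.
  have : (B i i - 1) ^+ d *: (delta_mx 0 i : 'rV_r) = 0.
    rewrite -[RHS]dE; elim: d {dE} => [|d IH]; first by rewrite scale1r.
    by rewrite iterS -IH /= -scalemxAl dB scalerA exprSr.
  move/eqP; rewrite scaler_eq0 expf_eq0 subr_eq0 => /orP[/andP[_ /eqP //]|/eqP/rowP/(_ i)].
  by rewrite !mxE !eqxx => /eqP; rewrite oner_eq0.
apply/Uset_predTP => i l; have [<-|il] := eqVneq i l.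
  by have := diag i; rewrite mxE.
by have := offdiag l i; rewrite mxE eq_sym => ->.
Qed.

End Radical.

(** * The quotients L_i / L_(i-1) *)

Section Layer.
Variable n : nat.

Let L : set G := Uset (fun i => ray_dim i < n.+1)%N.
Let K : set G := Uset (fun i => ray_dim i < n)%N.

(* Coordinates on L / K: the coefficients of the nonlinear monomials in the
   images of the variables of dimension n. *)
Let coords : seq ('I_r * 'X_{1..r}) :=
  [seq (i, m) | i <- [seq i <- enum 'I_r | ray_dim i == n], m <- nonlinear_mnms i].

Let coord (a : 'I_(size coords)) := tnth (in_tuple coords) a.

Let mem_coords i m : ((i, m) \in coords) = (ray_dim i == n) && nonlinear_mnm i m.
Proof.
apply/allpairsPdep/andP => [[i' [m' [ii' mm' [-> ->]]]]|[id im]].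
  by move: ii' mm'; rewrite mem_filter mem_nonlinear_mnms => /andP[].
by exists i, m; rewrite mem_filter id mem_enum mem_nonlinear_mnms.
Qed.

Let uniq_coords : uniq coords.
Proof.
apply: allpairs_uniq_dep => [|i _|]; first exact/filter_uniq/enum_uniq.
  exact: uniq_nonlinear_mnms.
by move=> [i m] [i' m'] _ _ /= [-> ->].
Qed.

Let coord_inj : injective coord.
Proof. by move=> a b; apply/tuple_uniqP; exact: uniq_coords. Qed.

Let coordP a : ray_dim (coord a).1 = n /\ nonlinear_mnm (coord a).1 (coord a).2.
Proof.
have : coord a \in coords := mem_tnth a (in_tuple coords).
by case: (coord a) => i m; rewrite mem_coords => /andP[/eqP].
Qed.

Definition layer_coord g : 'rV[k]_(size coords) :=
  \row_a (g 'X_((coord a).1))@_(coord a).2.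

Let layer_poly (u : 'rV[k]_(size coords)) i : A :=
  \sum_(a | (coord a).1 == i) u 0 a *: 'X_[(coord a).2].

Let nonlinear_layer_poly u i : nonlinear i (layer_poly u i).
Proof.
apply: (big_ind (nonlinear i)) => [|x y|a /eqP ai]; first exact: nonlinear0.
  exact: nonlinearD.
apply: nonlinearZ; apply/nonlinearP => m; rewrite msuppX inE => /eqP ->.
by rewrite -ai; case: (coordP a).
Qed.

Let layer_poly0 u i : ray_dim i != n -> layer_poly u i = 0.
Proof.
move=> din; rewrite /layer_poly big_pred0 // => a; apply: contraNF din => /eqP <-.
by case: (coordP a) => ->.
Qed.

Let layer_poly_coef u a : (layer_poly u (coord a).1)@_(coord a).2 = u 0 a.
Proof.
rewrite /layer_poly raddf_sum (bigD1 a) //= mcoeffZ mcoeffX eqxx mulr1 big1 ?addr0 //.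
move=> b /andP[/eqP ab ba]; rewrite mcoeffZ mcoeffX; case: eqP => [ab2|]; last by rewrite mulr0.
by case/eqP: ba; apply: coord_inj; apply/eqP; rewrite -pair_eqE /= ab ab2 !eqxx.
Qed.

Let coefX a : ('X_((coord a).1) : A)@_(coord a).2 = 0.
Proof.
have [_ /andP[_ a1]] := coordP a; rewrite mcoeffX; case: eqP => // E.
by rewrite -E mdeg1 in a1.
Qed.

(** The polynomials added to variables of dimension [n] involve only larger dimensions, so all these
    variables can be moved at once by one elementary automorphism. *)
Let section_ex : exists sigma : 'rV[k]_(size coords) -> G, forall u,
  (forall i, sigma u 'X_i = 'X_i + layer_poly u i) /\
  (forall i, (sigma u)^-1%g 'X_i = 'X_i - layer_poly u i).
Proof.
suff /choice[sigma sigmaE] : forall u, exists g : G,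
    (forall i, g 'X_i = 'X_i + layer_poly u i) /\
    (forall i, g^-1%g 'X_i = 'X_i - layer_poly u i) by exists sigma.
move=> u; apply: elementary_gaut => [i|i j].
  by case: (nonlinear_layer_poly u i).
have [din|din] := eqVneq (ray_dim i) n; last by rewrite layer_poly0 // => -[m]; rewrite msupp0.
move/(nonlinear_ray_lt (nonlinear_layer_poly u i))/ray_lt_dim; rewrite din => nj.
by rewrite layer_poly0 // gtn_eqF.
Qed.

(** For y_i of dimension [n], the displacement of y_i by [h] involves only variables of larger
    dimension. These are fixed by [g], so displacements add up. *)
Let layer_coordM g h : L g -> L h -> layer_coord (g * h)%g = layer_coord g + layer_coord h.
Proof.
move=> gL hL; apply/rowP => a; rewrite !mxE; case: (coordP a) => da _.
set i := (coord a).1 in da *.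
rewrite gautM_E -[h 'X_i](subrK 'X_i) raddfD /= mcoeffD addrC gaut_fixes.
  by rewrite mcoeffB coefX subr0 subrK.
move=> l /(nonlinear_ray_lt (hL i).1)/ray_lt_dim; rewrite da => nl.
by apply: (gL l).2; rewrite -leqNgt.
Qed.

Let layer_coord_kernel g : L g -> (layer_coord g = 0 <-> K g).
Proof.
move=> gL; split=> [g0 i|gK].
  split=> [|]; first by case: (gL i).
  rewrite -leqNgt leq_eqVlt => /predU1P[ni|]; last by move=> ni; apply: (gL i).2;
    rewrite -leqNgt.
  apply/eqP; rewrite -subr_eq0 (nonlinear_expansion (gL i).1); apply/eqP.
  rewrite big_seq big1 // => m; rewrite mem_nonlinear_mnms => im.
  have /tnthP[a aE] : (i, m) \in in_tuple coords by rewrite mem_coords -ni eqxx.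
  move/rowP/(_ a): g0; have := coefX a; rewrite !mxE -/(coord a) /coord -aE /= => X0 g0.
  by rewrite mcoeffB X0 g0 subrr scale0r.
apply/rowP => a; rewrite !mxE (gK _).2 ?coefX //.
by case: (coordP a) => ->; rewrite ltnn.
Qed.

Lemma layer_additive : additive_quotient reg L K.
Proof.
have [sigma sigmaE] := section_ex.
have sigmaL u : L (sigma u).
  move=> i; rewrite (sigmaE u).1 addrC addKr; split; first exact: nonlinear_layer_poly.
  by rewrite -leqNgt => ni; rewrite layer_poly0 ?addr0 // gtn_eqF.
have coord_sigma u : layer_coord (sigma u) = u.
  by apply/rowP => a; rewrite mxE (sigmaE u).1 mcoeffD coefX add0r layer_poly_coef.
have [L1 LM LV] : subgroup L := Uset_subgroup _.
have [K1 KM KV] : subgroup K := Uset_subgroup _.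
have KL : K `<=` L by apply: Uset_sub => i; apply: ltnW.
exists (size coords), layer_coord; split.
- exact: layer_coordM.
- by move=> u; exists (sigma u).
- exact: layer_coord_kernel.
move=> f; split=> [[[f' reg_f' ff'] f_inv]|[p fp]].
  (* An invariant function is determined by its values on the section, where the coefficients of
     [sigma u] and of its inverse are affine in [u]; the sign [b] in [coef] covers both. *)
  have [p pE] : exists p : {mpoly k[size coords]}, forall u, f' (sigma u) = p.@[fun a => u 0 a].
    have coef (b : bool) i m : exists p : {mpoly k[size coords]}, forall u,
        ('X_i + (-1) ^+ b *: layer_poly u i)@_m = p.@[fun a => u 0 a].
      exists ((('X_i : A)@_m)%:MP + \sum_(a | (coord a).1 == i)
         ((-1) ^+ b * ((coord a).2 == m)%:R) *: 'X_a) => u.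
      rewrite mcoeffD mcoeffZ mevalD mevalC raddf_sum mulr_sumr raddf_sum /=; congr (_ + _).
      apply: eq_bigr => a _.
      by rewrite mcoeffZ mcoeffX mevalZ mevalXU mulrA [LHS]mulrAC.
    elim: reg_f' => [a|i m|i m|f1 f2 _ [p pE] _ [q qE]|f1 f2 _ [p pE] _ [q qE]].
    - by exists a%:MP => u; rewrite mevalC.
    - have [p pE] := coef false i m; exists p => u.
      by rewrite -pE (sigmaE u).1 expr0 scale1r.
    - have [p pE] := coef true i m; exists p => u.
      by rewrite -pE (sigmaE u).2 expr1 scaleN1r.
    - by exists (p + q) => u; rewrite mevalD pE qE.
    by exists (p * q) => u; rewrite mevalM pE qE.
  exists p => g gL; rewrite -pE.
  have sL := sigmaL (layer_coord g); set s := sigma _ in sL *.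
  (* [g] and [s] have equal layer coordinates, hence lie in one coset of [K]. *)
  have sVgK : K (s^-1 * g)%g.
    apply/layer_coord_kernel; first by apply: LM => //; apply: LV.
    apply: (addrI (layer_coord s)); rewrite -layer_coordM //; last by apply: LM => //;
      apply: LV.
    by rewrite mulVKg coord_sigma addr0.
  by rewrite -ff' // -(f_inv s _ sL sVgK) mulVKg.
have p_reg : reg (fun g => p.@[fun a => layer_coord g 0 a]).
  pose P (x : {mpoly k[size coords]}) := reg (fun g => x.@[fun a => layer_coord g 0 a]).
  apply: (@mpoly_ring_ind k _ P p) => [b|a _|x y hx hy|x y hx hy]; rewrite /P.
  - rewrite (_ : (fun _ => _) = (fun=> b)); first exact: GRconst.
    by apply/funext => g; rewrite mevalC.
  - rewrite (_ : (fun _ => _) = (fun g => (g 'X_((coord a).1))@_(coord a).2));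
      first exact: GRcoef.
    by apply/funext => g; rewrite mevalXU mxE.
  - rewrite (_ : (fun _ => _) = (fun g => x.@[fun a => layer_coord g 0 a] + y.@[fun a =>
      layer_coord g 0 a])).
      exact: GRadd.
    by apply/funext => g; rewrite mevalD.
  rewrite (_ : (fun _ => _) = (fun g => x.@[fun a => layer_coord g 0 a] * y.@[fun a =>
    layer_coord g 0 a])).
    exact: GRmul.
  by apply/funext => g; rewrite mevalM.
split; first by exists (fun g => p.@[fun a => layer_coord g 0 a]).
move=> g h gL hK; rewrite !fp //; last by apply: LM => //; apply: KL.
have h0 := (layer_coord_kernel (KL _ hK)).2 hK.
by apply: meval_eq => a; rewrite layer_coordM ?h0 ?addr0 //; apply: KL.
Qed.

End Layer.

End CoxRing.

Unset Implicit Arguments.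

Theorem theorem6p14 (k : closedFieldType) (M : zmodType)
    (Delta : set (set (M -> rat))) (r : nat) (v : 'I_r -> {additive M -> int})
    (N : zmodType) (pi : {additive 'rV[int]_r -> N})
    (char0 : [pchar k] =i pred0)
    (freeM : free_of_finite_rank M)
    (fanD : is_fan Delta)
    (completeD : complete_fan Delta)
    (raysD : rays_of Delta v)
    (classN : class_group_sequence v pi) :
  let reg : set (gaut k pi -> k) := gaut_regular pi in
  let Ru := unipotent_radical reg (identity_component reg) in
  let l := max_dim pi in
  let L (i : nat) := E_prod pi k i.+1 in
  [/\ (* a *)
      (forall i, (i <= l)%N -> closed_subgroup reg (L i) /\ L i `<=` Ru),
      (* b *)
      alg_isomorphic reg (L l) Ru
    & (* c *)
      (forall i, (i <= l)%N ->
         normal_in (L i) Ru /\ additive_quotient reg (L i) (E_prod pi k i))].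
Proof.
have [c [c_gt0 cv0]] := positive_relation fanD completeD raysD.
have c_pi n : pi n = 0 -> \sum_(i < r) (c i)%:Z * n 0 i = 0.
  have [_ exact_pi _] := classN.
  by move=> /exact_pi[a ->]; rewrite -[RHS](cv0 a); apply: eq_bigr => i _; rewrite mxE.
move=> reg Ru l L.
have LE i : L i = @Uset k r N pi (fun j => ray_dim pi j < i.+1)%N by apply: E_prodE.
have RuE : Ru = @Uset k r N pi predT.
  apply/seteqP; split.
    exact: (radical_sub_Uset c_gt0 c_pi char0 (@nilpotent_trace k r)).
  exact: (Uset_sub_radical c_gt0 c_pi char0).
have LlE : L l = Ru by rewrite LE RuE; apply: Uset_dim_predT.
split=> [i _||i _].
- rewrite LE RuE; split; last exact: Uset_sub_predT.
  by split; [exact: (Uset_subgroup k c_gt0 c_pi) | exact: Uset_closed].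
(* The two groups coincide as subsets of the automorphism group, so the identity is the
   isomorphism. *)
- rewrite LlE; exists id, id; split=> // f reg_f; exists f => //.
rewrite LE RuE (E_prodE k c_gt0 c_pi) //; split; first exact: (Uset_normal k c_gt0 c_pi).
exact: (layer_additive k c_gt0 c_pi).
Qed.
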